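(* Let $\widetilde{p} \in C^{1}(\Omega)\cap C^{0}(\overline{\Omega})$ be (the pressure component of) a solution $(\widetilde{p},\mathbf{v})$ of the boundary value problem (Barus model with conservative body force) $$\widetilde{\mu}_0(\mathbf{x})\, g(\widetilde{p}(\mathbf{x}))\,\mathbf{K}^{-1}(\mathbf{x})\,\mathbf{v}(\mathbf{x}) + \mathrm{grad}[\widetilde{p}(\mathbf{x})] = \mathbf{0} \ \text{in } \Omega,\qquad \mathrm{div}[\mathbf{v}(\mathbf{x})]=0 \ \text{in } \Omega,$$ $$\widetilde{p}(\mathbf{x})=\widetilde{p}_{\mathrm{p}}(\mathbf{x})\ \text{on } \Gamma^{p},\qquad \mathbf{v}(\mathbf{x})\cdot\widehat{\mathbf{n}}(\mathbf{x}) = v_n(\mathbf{x})\ \text{on } \Gamma^{v}.$$ If $v_n(\mathbf{x})\ge 0$ on $\Gamma^{v}$, then $$\max_{\mathbf{y}\in\Gamma^{p}}\big[\widetilde{p}_{\mathrm{p}}(\mathbf{y})\big]\ge \widetilde{p}(\mathbf{x})\qquad \forall\,\mathbf{x}\in\overline{\Omega}.$$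
   Context: $\Omega\subset\mathbb{R}^{nd}$ is a bounded Lipschitz domain (open and connected) with boundary $\partial\Omega=\overline{\Omega}\setminus\Omega$ and unit outward normal $\widehat{\mathbf{n}}$. The boundary is partitioned as $\Gamma^{p}\cup\Gamma^{v}=\partial\Omega$, $\Gamma^{p}\cap\Gamma^{v}=\emptyset$, with $\Gamma^{p}\neq\emptyset$. Maxima over $\Gamma^{p}$ are read as suprema if not attained. The permeability $\mathbf{K}(\mathbf{x})$ is a symmetric tensor field for which there are constants $0<k_1\le k_2$ with $k_1\,\boldsymbol{\zeta}\cdot\boldsymbol{\zeta}\le \boldsymbol{\zeta}\cdot\mathbf{K}(\mathbf{x})\boldsymbol{\zeta}\le k_2\,\boldsymbol{\zeta}\cdot\boldsymbol{\zeta}$ for all $\mathbf{x}\in\Omega$ and all $\boldsymbol{\zeta}\in\mathbb{R}^{nd}\setminus\{\mathbf 0\}$. Constants: $\mu_0>0$ (reference viscosity), $p_0>0$ (reference pressure), $\beta\ge 0$. The body force is conservative, $\rho\mathbf{b}=-\mathrm{grad}[\xi]$ for a given scalar field $\xi$, and $\widetilde{p}=p+\xi$ is the modified pressure ($p$ being the pressure). Define $$\widetilde{\mu}_0(\mathbf{x})=\mu_0\exp\!\left[-\frac{\beta\,\xi(\mathbf{x})}{p_0}\right]>0,\qquad g(s)=\exp\!\left[\beta\left(\frac{s}{p_0}-1\right)\right].$$ The boundary value problem is understood in the weak sense: $\widetilde{p}\in H^1(\Omega)\cap C^1(\Omega)\cap C^0(\overline{\Omega})$, $\widetilde{p}=\widetilde{p}_{\mathrm{p}}$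 on $\Gamma^{p}$, $\mathbf{v}=-\frac{1}{\widetilde{\mu}_0\,g(\widetilde{p})}\mathbf{K}\,\mathrm{grad}[\widetilde{p}]$ in $\Omega$, and $\int_{\Omega}\mathrm{grad}[w]\cdot\mathbf{v}\,\mathrm{d}\Omega=\int_{\Gamma^{v}}w\,v_n\,\mathrm{d}\Gamma$ for all $w\in H^1(\Omega)$ with zero trace on $\Gamma^{p}$. The prescribed data $v_n$ is a function on $\Gamma^{v}$ for which the boundary integral is well defined. *)

(* Defs.v *)
(* R^N is 'rV[R]_N: vectors are row vectors *)
From HB Require Import structures.
From mathcomp Require Import all_boot all_order all_algebra.
From mathcomp Require Import all_classical all_reals all_analysis.

Set Implicit Arguments.
Unset Strict Implicit.
Unset Printing Implicit Defensive.

Import Order.TTheory GRing.Theory Num.Theory.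
Import numFieldNormedType.Exports.

Local Open Scope classical_set_scope.
Local Open Scope ring_scope.

(* The outer measure generated by a gauge on all subsets of T. Restricting the
   covering sets to a class is done by giving the other sets the gauge +oo. *)
Section gauge_outer_measure.
Context {R : realType} {T : pointedType}.
Implicit Type tau : set T -> \bar R.
Local Open Scope ereal_scope.

Definition gauge_outer tau (X : set T) : \bar R :=
  ereal_inf [set \sum_(k <oo) tau (A k) |
    A in [set A : (set T)^nat | X `<=` \bigcup_k A k]].

Let discrete := g_sigma_algebraType [set: set T].

Let gauge_outerE tau :
  gauge_outer tau = mu_ext (tau : set discrete -> \bar R).
Proof.
apply/funext => X; rewrite /gauge_outer /mu_ext; congr ereal_inf.
apply/seteqP; split => _ [A AX <-]; exists A => //; last by case: AX.
by split => // k; apply: sub_sigma_algebra.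
Qed.

Variable tau : set T -> \bar R.
Hypotheses (tau0 : tau set0 = 0) (tau_ge0 : forall A, 0 <= tau A).

Lemma gauge_outer0 : gauge_outer tau set0 = 0.
Proof. by rewrite gauge_outerE; exact: mu_ext0. Qed.

Lemma gauge_outer_ge0 A : 0 <= gauge_outer tau A.
Proof. by rewrite gauge_outerE; exact: mu_ext_ge0. Qed.

Lemma le_gauge_outer : {homo gauge_outer tau : A B / A `<=` B >-> A <= B}.
Proof. by move=> A B AB; rewrite gauge_outerE; exact: le_mu_ext. Qed.

Lemma gauge_outer_sigma_subadditive : sigma_subadditive (gauge_outer tau).
Proof.
rewrite gauge_outerE.
exact: (@mu_ext_sigma_subadditive _ discrete R tau tau_ge0).
Qed.

End gauge_outer_measure.

Section lebesgue.
Context {R : realType} (N : nat).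
Local Open Scope ereal_scope.

Definition ocbox (a b : 'rV[R]_N) : set 'rV[R]_N :=
  [set x | forall i, (a 0%R i < x 0%R i <= b 0%R i)%R].

Definition box_volume (a b : 'rV[R]_N) : R :=
  (\prod_(i < N) (b 0 i - a 0 i))%R.

(* +oo on sets that are not boxes *)
Definition box_gauge (A : set 'rV[R]_N) : \bar R :=
  if A == set0 then 0 else
  ereal_inf [set (box_volume ab.1 ab.2)%:E |
    ab in [set ab : 'rV[R]_N * 'rV[R]_N | A = ocbox ab.1 ab.2]].

Definition lebesgue_outer : set 'rV[R]_N -> \bar R := gauge_outer box_gauge.

Let box_gauge0 : box_gauge set0 = 0.
Proof. by rewrite /box_gauge eqxx. Qed.

Let box_gauge_ge0 A : 0 <= box_gauge A.
Proof.
rewrite /box_gauge; case: ifPn => // /set0P[x Ax].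
apply: le_ereal_inf_tmp => _ [[a b] /= AE <-]; rewrite lee_fin.
apply: prodr_ge0 => i _; rewrite subr_ge0.
by move: Ax; rewrite AE => /(_ i)/andP[/ltW ax xb]; exact: le_trans xb.
Qed.

HB.instance Definition _ := isOuterMeasure.Build R 'rV[R]_N lebesgue_outer
  (gauge_outer0 box_gauge0 box_gauge_ge0) (gauge_outer_ge0 box_gauge_ge0)
  (@le_gauge_outer _ _ _)
  (gauge_outer_sigma_subadditive box_gauge_ge0).

Definition lebesgue_om : {outer_measure set 'rV[R]_N -> \bar R} :=
  lebesgue_outer.

(* defined on all Lebesgue measurable sets, not only on the Borel sets *)
Definition lebesgue_rV :
    {measure set (caratheodory_type lebesgue_om) -> \bar R} :=
  lebesgue_om.

End lebesgue.

Section euclidean.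
Context {R : realType} {N : nat}.
Implicit Types u v : 'rV[R]_N.

Definition dotv u v : R := \sum_(i < N) u 0 i * v 0 i.

(* `|u| is the sup norm on 'rV[R]_N *)
Definition enorm u : R := Num.sqrt (dotv u u).

Definition ediam (A : set 'rV[R]_N) : \bar R :=
  ereal_sup [set (enorm (xy.1 - xy.2))%:E | xy in A `*` A].

Definition gradient (f : 'rV[R]_N -> R) (x : 'rV[R]_N) : 'rV[R]_N :=
  \row_i 'D_(delta_mx 0 i) f x.

(* meant for open D *)
Definition C1_on (D : set 'rV[R]_N) (f : 'rV[R]_N -> R) : Prop :=
  (forall x, D x -> differentiable f x) /\
  (forall x, D x -> {for x, continuous (gradient f)}).

(* C^1 with compact support in D; for first-order weak derivatives these test
   functions give the same notion as the smooth ones *)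
Definition test_function (D : set 'rV[R]_N) (phi : 'rV[R]_N -> R) : Prop :=
  [/\ C1_on setT phi, compact (closure [set x | phi x != 0])
    & closure [set x | phi x != 0] `<=` D].

End euclidean.

(* s-dimensional Hausdorff measure in R^N, with the factor omega_s / 2^s
   (the volume of a Euclidean ball of diameter 1 in R^s) that makes it coincide
   with s-dimensional area *)
Section hausdorff.
Context {R : realType} (N s : nat).
Local Open Scope ereal_scope.

Definition hausdorff_factor : \bar R :=
  lebesgue_outer [set x : 'rV[R]_s | (enorm x <= 2^-1)%R].

Definition hausdorff_gauge (delta : R) (A : set 'rV[R]_N) : \bar R :=
  if A == set0 then 0 else
  if ediam A <= delta%:E then hausdorff_factor * ediam A ^+ s else +oo.

Definition hausdorff_outer (X : set 'rV[R]_N) : \bar R :=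
  ereal_sup [set gauge_outer (hausdorff_gauge delta) X |
    delta in [set delta : R | (0 < delta)%R]].

Let hausdorff_gauge0 delta : hausdorff_gauge delta set0 = 0.
Proof. by rewrite /hausdorff_gauge eqxx. Qed.

Let hausdorff_gauge_ge0 delta A : 0 <= hausdorff_gauge delta A.
Proof.
rewrite /hausdorff_gauge; case: ifPn => // /set0P[x Ax].
case: ifP => // _; apply: mule_ge0; first exact: outer_measure_ge0.
apply: expe_ge0; apply: (@le_trans _ _ (enorm (x - x))%:E).
  by rewrite lee_fin sqrtr_ge0.
by apply: ereal_sup_ubound; exists (x, x).
Qed.

Let hausdorff_outer0 : hausdorff_outer set0 = 0.
Proof.
apply/eqP; rewrite eq_le; apply/andP; split.
  by apply: ge_ereal_sup => _ [d _ <-]; rewrite gauge_outer0.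
by apply: ereal_sup_ubound; exists 1%R; [exact: ltr01|rewrite gauge_outer0].
Qed.

Let hausdorff_outer_ge0 A : 0 <= hausdorff_outer A.
Proof.
apply: (@le_trans _ _ (gauge_outer (hausdorff_gauge 1) A)).
  exact: gauge_outer_ge0.
by apply: ereal_sup_ubound; exists 1%R => //=; exact: ltr01.
Qed.

Let le_hausdorff_outer : {homo hausdorff_outer : A B / A `<=` B >-> A <= B}.
Proof.
move=> A B AB; apply: ge_ereal_sup => _ [d d0 <-].
apply: (@le_trans _ _ (gauge_outer (hausdorff_gauge d) B)).
  exact: le_gauge_outer.
by apply: ereal_sup_ubound; exists d.
Qed.

Let hausdorff_outer_sigma_subadditive : sigma_subadditive hausdorff_outer.
Proof.
move=> F; apply: ge_ereal_sup => _ [d d0 <-].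
apply: (@le_trans _ _ (\sum_(i <oo) gauge_outer (hausdorff_gauge d) (F i))).
  exact: gauge_outer_sigma_subadditive.
apply: lee_nneseries => [i _ _|i _]; first exact: gauge_outer_ge0.
by apply: ereal_sup_ubound; exists d.
Qed.

HB.instance Definition _ := isOuterMeasure.Build R 'rV[R]_N hausdorff_outer
  hausdorff_outer0 hausdorff_outer_ge0 le_hausdorff_outer
  hausdorff_outer_sigma_subadditive.

Definition hausdorff_om : {outer_measure set 'rV[R]_N -> \bar R} :=
  hausdorff_outer.

Definition hausdorff :
    {measure set (caratheodory_type hausdorff_om) -> \bar R} :=
  hausdorff_om.

End hausdorff.

Arguments lebesgue_rV : clear implicits.
Arguments hausdorff_om : clear implicits.
Arguments hausdorff : clear implicits.

Section domain.
Context {R : realType} {n : nat}.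
Local Notation E := 'rV[R]_n.+1.
Implicit Types (D : set E) (f w t : E -> R) (G : E -> E).

Definition boundary D : set E := closure D `\` D.

(* near each boundary point, in suitable Cartesian coordinates z = y *m Q,
   D is the set above the graph of a Lipschitz function of z_1, ..., z_n *)
Definition lipschitz_boundary D : Prop :=
  forall x, boundary D x ->
  exists (Q : 'M[R]_n.+1) (gamma : 'rV[R]_n -> R) (L r : R),
    [/\ Q *m Q^T = 1%:M, L.-lipschitz gamma, 0 < r &
      forall y, ball x r y ->
        (D y <-> gamma (col' ord0 (y *m Q)) < (y *m Q) 0 ord0)].

Definition lipschitz_domain D : Prop :=
  [/\ open D, connected D, bounded_set D & lipschitz_boundary D].

Local Notation leb := (lebesgue_rV R n.+1).

Definition surface_space := caratheodory_type (hausdorff_om R n.+1 n).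

Definition surface : {measure set surface_space -> \bar R} :=
  hausdorff R n.+1 n.

(* Functions on D are total functions, of which only the restriction to D
   matters: f \_ D is f on D and 0 elsewhere. *)
Definition L2_on D f : Prop := (f \_ D : caratheodory_type _ -> R)
  \in Lfun leb 2%:E.

Definition weak_gradient D w G : Prop :=
  forall phi, test_function D phi -> forall i : 'I_n.+1,
    (\int[leb]_(x in D) (w x * gradient phi x 0 i)%:E =
     - \int[leb]_(x in D) (G x 0 i * phi x)%:E)%E.

(* w belongs to H^1(D), and its weak gradient is G *)
Definition H1_with D w G : Prop :=
  [/\ L2_on D w, forall i, L2_on D (fun x => G x 0 i) & weak_gradient D w G].

Definition H1 D w : Prop := exists G, H1_with D w G.

Definition L2_cvg D (u : (E -> R)^nat) w : Prop :=
  ('N[leb]_2%:E[EFin \o ((u k \- w)%R \_ D)] @[k --> \oo] --> 0)%E.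

(* t represents the boundary trace of w. The trace operator is the continuous
   extension to H^1(D) of the restriction u |-> u|_(boundary D), defined for u
   in H^1(D) continuous up to the boundary; thus its graph is the closure in
   H^1(D) x L^2(boundary D) of the graph of the restriction. (Being a
   measurable L^2 limit, t is in L^2(boundary D).) *)
Definition trace D w t : Prop :=
  measurable_fun (boundary D : set surface_space) t /\
  exists G (u : (E -> R)^nat) (U : (E -> E)^nat),
    [/\ H1_with D w G,
        forall k, H1_with D (u k) (U k) /\ {within closure D, continuous (u k)},
        L2_cvg D u w,
        forall i, L2_cvg D (fun k x => U k x 0 i) (fun x => G x 0 i) &
        (\int[surface]_(x in boundary D) ((u k x - t x) ^+ 2)%:E
          @[k --> \oo] --> 0)%E].

Definition vanishes_on (Gam : set E) t : Prop :=
  {ae surface, forall x, Gam x -> t x = 0}.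

(* reference viscosity modified by the potential of the body force *)
Definition modified_viscosity (mu0 p0 beta : R) (xi : E -> R) (x : E) : R :=
  mu0 * expR (- (beta * xi x / p0)).

Definition barus (p0 beta s : R) : R := expR (beta * (s / p0 - 1)).

Record weak_solution (Om Gp Gv : set E) (K : E -> 'M[R]_n.+1)
    (mu0 p0 beta : R) (xi pp vn p : E -> R) (v : E -> E) : Prop := {
  pressure_H1 : H1 Om p ;
  pressure_C1 : C1_on Om p ;
  pressure_C0 : {within closure Om, continuous p} ;
  pressure_bc : forall x, Gp x -> p x = pp x ;
  (* with row vectors, K u is u *m K^T *)
  velocityE : forall x, Om x ->
    v x = - (modified_viscosity mu0 p0 beta xi x * barus p0 beta (p x))^-1
            *: (gradient p x *m (K x)^T) ;
  (* integrability states that both integrals are well defined *)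
  weak_balance : forall w G t,
    H1_with Om w G -> trace Om w t -> vanishes_on Gp t ->
    [/\ leb.-integrable Om (fun x => (dotv (G x) (v x))%:E),
        surface.-integrable setT (EFin \o ((t \* vn) \_ Gv)) &
        (\int[leb]_(x in Om) (dotv (G x) (v x))%:E =
         \int[surface]_(x in Gv) (t x * vn x)%:E)%E]
}.

End domain.

(* Main.v *)
(* Test the weak balance with w = max(0, p - m)^2, where m is the supremum of
   the data on Gp: w is C^1 in Om, vanishes on Gp, and its weak gradient is
   2 max(0, p - m) grad p. By ellipticity grad w . v <= 0, while the boundary
   term is nonnegative, so grad p = 0 almost everywhere, hence everywhere, on
   {p > m}. If this set meets Om, p is a constant > m on the connected set Om,
   contradicting its values on Gp.

   To see that w is in H^1(Om) one needs that grad p, defined pointwise, is in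
   L^2(Om) as soon as the weak gradient of p is. No mollification is needed: p
   is C^1, so its own difference quotients times a cutoff are test functions,
   and in the limit they bound the L^2 norm of grad p by that of the weak
   gradient. *)
Require Import Defs.
From mathcomp Require Import all_boot all_order all_algebra.
From mathcomp Require Import all_classical all_reals all_analysis.
From mathcomp Require Import measurable_realfun ring lra.

Set Implicit Arguments.
Unset Strict Implicit.
Unset Printing Implicit Defensive.

Import Order.TTheory GRing.Theory Num.Theory.
Import numFieldNormedType.Exports.

Local Open Scope classical_set_scope.
Local Open Scope ring_scope.

(** * Lebesgue outer measure *)

(** The square in the test function makes [w] C^1 across the level [m], so integration by parts
    identifies its pointwise gradient as its weak gradient. The factor [max(0, p - m)] left in that
    gradient is harmless, being positive exactly where grad p has to vanish. The viscosity enters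
    only through a positive factor, which may vary from point to point: the strict sign, not a
    uniform bound, is what counts. Both measures are Caratheodory restrictions of outer measures
    defined by covers, so their properties are extracted from covers. Lebesgue measure has to
    provide measurable open sets, translation invariance (the source of integration by parts) and
    boxes of positive volume, which make a null open set empty. Surface measure has to provide
    measurability of continuous functions on the boundary; the boundary integral then enters through
    its sign. *)

Section gauge_outer_theory.
Context {R : realType} {T : pointedType}.
Implicit Type tau : set T -> \bar R.
Local Open Scope ereal_scope.

Lemma gauge_outer_le tau A :
  tau set0 = 0 -> (forall B, 0 <= tau B) -> gauge_outer tau A <= tau A.
Proof.
move=> tau0 tau_ge0.
pose F := fun k : nat => if k is 0%N then A else set0.
apply: ge_ereal_inf; exists (tau A) => //; exists F.
  by move=> x Ax; exists 0%N.
rewrite nneseries_recl//=.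
by rewrite [X in _ + X](_ : _ = 0) ?adde0// eseries0// => -[|k].
Qed.

(** Every set of a cover of the union is split in two; the first pieces cover [X], the second ones
    [Y]. The hypothesis fits boxes cut by a hyperplane as well as small sets that cannot meet two
    distant sets. *)
Lemma gauge_outerD_le tau X Y :
  (forall B, 0 <= tau B) ->
  (forall E, exists E1 E2, [/\ E `&` X `<=` E1, E `&` Y `<=` E2 &
     tau E1 + tau E2 <= tau E]) ->
  gauge_outer tau X + gauge_outer tau Y <= gauge_outer tau (X `|` Y).
Proof.
move=> tau_ge0 split_tau.
have [s1 /choice[s2 sP]] := choice split_tau.
apply: le_ereal_inf_tmp => _ [A XYA <-].
apply: (@le_trans _ _ (\sum_(k <oo) (tau (s1 (A k)) + tau (s2 (A k))))); last first.
  apply: lee_nneseries => k _; first by rewrite adde_ge0.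
  by have [] := sP (A k).
rewrite nneseriesD//; apply: leeD.
- apply: ge_ereal_inf; eexists; last exact: lexx.
  exists (s1 \o A) => // x Xx; have [k _ Akx] := XYA x (or_introl Xx).
  by exists k => //=; have [+ _ _] := sP (A k); exact.
- apply: ge_ereal_inf; eexists; last exact: lexx.
  exists (s2 \o A) => // x Xx; have [k _ Akx] := XYA x (or_intror Xx).
  by exists k => //=; have [_ + _] := sP (A k); exact.
Qed.

Lemma gauge_outer_preimage tau (f : T -> T) X :
  (forall E, tau (f @^-1` E) <= tau E) -> (forall E, 0 <= tau E) ->
  gauge_outer tau (f @^-1` X) <= gauge_outer tau X.
Proof.
move=> ftau tau_ge0; apply: le_ereal_inf_tmp => _ [A XA <-].
apply: (@le_trans _ _ (\sum_(k <oo) tau (f @^-1` A k))); last first.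
  by apply: lee_nneseries => k _ //.
apply: ge_ereal_inf; eexists; last exact: lexx.
exists (fun k => f @^-1` A k) => // x /XA[k _ Akx].
by exists k.
Qed.

End gauge_outer_theory.

Section box_gauge_theory.
Context {R : realType} {N : nat}.
Implicit Types (a b x : 'rV[R]_N) (A E : set 'rV[R]_N).

(** Moving a single coordinate of a point of the box tests an inclusion of boxes one side at a time.
    Uniqueness of the corners makes the infimum in [box_gauge] run over a single volume. *)
Lemma ocbox_inj a b a' b' x : ocbox a b x -> ocbox a b = ocbox a' b' ->
  a = a' /\ b = b'.
Proof.
have sub (c d c' d' y : 'rV[R]_N) : ocbox c d y -> ocbox c d `<=` ocbox c' d' ->
    forall i, c' 0 i <= c 0 i /\ d 0 i <= d' 0 i.
  move=> cdy cd i; pose z t : 'rV[R]_N := \row_j (if j == i then t else y 0 j).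
  have cdz t : c 0 i < t <= d 0 i -> ocbox c' d' (z t).
    move=> tcd; apply: cd => j; rewrite mxE; case: eqP => [->//|_]; exact: cdy.
  have cdi := cdy i.
  split; rewrite leNgt; apply/negP => h.
    (* This value lies in the interval of the first box but not above [c' 0 i], so the moved point
       is outside the second box. *)
    have /cdz : c 0 i < Num.min (c' 0 i) (d 0 i) <= d 0 i.
      rewrite ge_min lexx orbT andbT lt_min h/=.
      by case/andP: cdi => /lt_le_trans /[apply].
    by move=> /(_ i); rewrite mxE eqxx => /andP[]; rewrite lt_min ltxx.
  have /cdz : c 0 i < d 0 i <= d 0 i.
    by rewrite lexx andbT; case/andP: cdi => /lt_le_trans /[apply].
  by move=> /(_ i); rewrite mxE eqxx leNgt h andbF.
move=> abx e; have abx' : ocbox a' b' x by rewrite -e.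
have s1 := sub _ _ a' b' _ abx; have s2 := sub _ _ a b _ abx'.
rewrite e in s1; rewrite e in s2.
split; apply/rowP => i; apply/eqP; rewrite eq_le.
  by rewrite (proj1 (s1 (fun=> id) i)) (proj1 (s2 (fun=> id) i)).
by rewrite (proj2 (s1 (fun=> id) i)) (proj2 (s2 (fun=> id) i)).
Qed.

Lemma box_gauge_ocbox a b x : ocbox a b x ->
  box_gauge (ocbox a b) = (box_volume a b)%:E.
Proof.
move=> abx; rewrite /box_gauge ifF; last by apply/eqP => /seteqP[/(_ x abx)].
rewrite (_ : [set _ | _ in _] = [set (box_volume a b)%:E]) ?ereal_inf1//.
apply/seteqP; split => [_ [[a' b'] /= e <-]|_ ->]; last by exists (a, b).
by have [<- <-] := ocbox_inj abx e.
Qed.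

Lemma box_gauge0 : box_gauge (set0 : set 'rV[R]_N) = 0%E.
Proof. by rewrite /box_gauge eqxx. Qed.

Lemma box_gauge_ge0 E : (0 <= box_gauge E)%E.
Proof.
rewrite /box_gauge; case: ifPn => // /set0P[x Ax].
apply: le_ereal_inf_tmp => _ [[a b] /= AE <-]; rewrite lee_fin.
apply: prodr_ge0 => i _; rewrite subr_ge0.
by move: Ax; rewrite AE => /(_ i)/andP[/ltW ax xb]; exact: le_trans xb.
Qed.

Variant box_gauge_spec E : \bar R -> Prop :=
  | BoxGauge0 of E = set0 : box_gauge_spec E 0%E
  | BoxGaugeBox a b x of E = ocbox a b & E x :
      box_gauge_spec E (box_volume a b)%:E
  | BoxGaugey : box_gauge_spec E +oo%E.

Lemma box_gaugeP E : box_gauge_spec E (box_gauge E).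
Proof.
have [->|/set0P[x Ex]] := eqVneq E set0.
  by rewrite box_gauge0; constructor.
have [[[a b] Eab]|nE] := pselect (exists ab, E = ocbox ab.1 ab.2).
  rewrite Eab (@box_gauge_ocbox _ _ x) -?Eab//.
  by apply: (BoxGaugeBox (x := x)) => //.
rewrite /box_gauge ifF; last by apply/eqP => /seteqP[/(_ x Ex)].
rewrite (_ : [set _ | _ in _] = set0) ?ereal_inf0; first by constructor.
by apply/seteqP; split => // _ [ab /= e _]; apply: nE; exists ab.
Qed.

(** The hyperplane cuts a box into two boxes whose volumes add up; sets that are not boxes have
    infinite gauge. *)
Lemma lebesgue_halfspace (i : 'I_N) (c : R) :
  (@lebesgue_om R N).-caratheodory [set x : 'rV[R]_N | x 0 i <= c].
Proof.
apply: le_caratheodory_measurable => X /=.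
rewrite -[X in (_ <= _ X)%E](setUIDK X [set x : 'rV[R]_N | x 0 i <= c]) setDE.
apply: gauge_outerD_le; first exact: box_gauge_ge0.
move=> E; exists (E `&` [set x : 'rV[R]_N | x 0 i <= c]).
exists (E `\` [set x : 'rV[R]_N | x 0 i <= c]).
split; [by move=> x [? [? ?]]|by move=> x [? [? ?]]|].
case: (box_gaugeP E) => [->|a b x0 Eab Ex0|]; last by rewrite leey.
  by rewrite set0I set0D box_gauge0 adde0.
(* A box on one side of the hyperplane is treated apart: one piece is empty, and its gauge is 0
   rather than a product of differences. *)
have [bc|cb] := leP (b 0 i) c.
  rewrite [X in (_ + box_gauge X)%E](_ : _ = set0); last first.
    apply/seteqP; split => // x; rewrite Eab => -[/(_ i)/andP[_ xb]] /=.
    by apply; exact: le_trans bc.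
  rewrite box_gauge0 adde0 (_ : E `&` _ = E).
    by rewrite Eab (@box_gauge_ocbox _ _ x0) -?Eab.
  apply/seteqP; split => [x []//|x]; rewrite Eab => /[dup] abx /(_ i)/andP[_ xb].
  by split => //=; exact: le_trans bc.
have [ca|ac] := leP c (a 0 i).
  rewrite [X in (box_gauge X + _)%E](_ : _ = set0); last first.
    apply/seteqP; split => // x; rewrite Eab => -[/(_ i)/andP[ax _]] /=.
    by rewrite leNgt (le_lt_trans ca ax).
  rewrite box_gauge0 add0e (_ : E `\` _ = E).
    by rewrite Eab (@box_gauge_ocbox _ _ x0) -?Eab.
  apply/seteqP; split => [x []//|x]; rewrite Eab => /[dup] abx /(_ i)/andP[ax _].
  by split => //=; apply/negP; rewrite -ltNge (le_lt_trans ca).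
pose upd (y : 'rV[R]_N) t : 'rV[R]_N := \row_j (if j == i then t else y 0 j).
have -> : E `&` [set x : 'rV[R]_N | x 0 i <= c] = ocbox a (upd b c).
  rewrite Eab; apply/seteqP; split => [x [abx xc] j|x abx].
    by rewrite !mxE; case: eqP => [->|_]; rewrite ?abx//; case/andP: (abx i) => ->.
  split; last by have /andP[_] := abx i; rewrite mxE eqxx.
  move=> j; have := abx j; rewrite mxE; case: eqP => [->|_]//.
  by case/andP => -> xc; rewrite (le_trans xc)// ltW.
have -> : E `\` [set x : 'rV[R]_N | x 0 i <= c] = ocbox (upd a c) b.
  rewrite Eab; apply/seteqP; split => [x [abx /negP xc] j|x abx].
    rewrite !mxE; case: eqP => [->|_]; rewrite ?abx//; case/andP: (abx i) => _ ->.
    by rewrite ltNge xc.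
  split; last by have /andP[+ _] := abx i; rewrite mxE eqxx ltNge => /negP.
  move=> j; have := abx j; rewrite mxE; case: eqP => [->|_]//.
  by case/andP => xc ->; rewrite (lt_trans _ xc).
have abx0 : ocbox a b x0 by rewrite -Eab.
(* The volume formula asks for a point of each piece: [x0] with coordinate [i] moved to the top of
   the lower piece, then of the upper one. *)
rewrite (@box_gauge_ocbox _ _ (upd x0 c)); last first.
  by move=> j; rewrite !mxE; case: eqP => [->|_]; rewrite ?lexx ?ac// abx0.
rewrite (@box_gauge_ocbox _ _ (upd x0 (b 0 i))); last first.
  by move=> j; rewrite !mxE; case: eqP => [->|_]; rewrite ?lexx ?cb// abx0.
rewrite -EFinD lee_fin /box_volume.
rewrite (bigD1 i)//= [X in _ + X](bigD1 i)//= [leRHS](bigD1 i)//= !mxE eqxx.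
rewrite (eq_bigr (fun j => b 0 j - a 0 j)); last first.
  by move=> j /negPf ji; rewrite !mxE ji.
rewrite [X in _ + _ * X](eq_bigr (fun j => b 0 j - a 0 j)); last first.
  by move=> j /negPf ji; rewrite !mxE ji.
by rewrite -mulrDl addrC addrA subrK.
Qed.

(** Pulling back a cover by boxes along a translation preserves volumes; the reverse inequality is
    the same one for [- h]. *)
Lemma lebesgue_translate (h : 'rV[R]_N) A :
  lebesgue_outer (shift h @^-1` A) = lebesgue_outer A.
Proof.
have gauge_shift k E : (box_gauge (shift k @^-1` E) <= box_gauge E)%E.
  case: (box_gaugeP E) => [->|a b x0 Eab Ex0|]; last by rewrite leey.
    by rewrite preimage_set0 box_gauge0.
  have -> : shift k @^-1` E = ocbox (a - k) (b - k).
    rewrite Eab; apply/seteqP; split => x xE j.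
      by have := xE j; rewrite !mxE ltrBlDr lerBrDr.
    by have := xE j; rewrite !mxE ltrBlDr lerBrDr.
  rewrite (@box_gauge_ocbox _ _ (x0 - k)).
    rewrite lee_fin /box_volume; apply: ler_prod => i _.
    rewrite !mxE opprD opprK addrACA addNr addr0 lexx andbT subr_ge0.
    by move: Ex0; rewrite Eab => /(_ i)/andP[/ltW+]; exact: le_trans.
  by move=> j; move: Ex0; rewrite Eab => /(_ j); rewrite !mxE lerD2r ltrD2r.
apply/eqP; rewrite eq_le; apply/andP; split.
  by apply: gauge_outer_preimage => //; exact: box_gauge_ge0.
rewrite -[X in (lebesgue_outer X <= _)%E](_ : shift (- h) @^-1` (shift h @^-1` A) = A).
  by apply: gauge_outer_preimage => //; exact: box_gauge_ge0.
by apply/seteqP; split => x /=; rewrite subrK.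
Qed.

Lemma lebesgue_ocbox_lty a b : (lebesgue_outer (ocbox a b) < +oo)%E.
Proof.
apply: (@le_lt_trans _ _ (box_gauge (ocbox a b))).
  by apply: gauge_outer_le; [exact: box_gauge0|exact: box_gauge_ge0].
have [->|/set0P[x abx]] := eqVneq (ocbox a b) set0.
  by rewrite box_gauge0 ltry.
by rewrite (box_gauge_ocbox abx) ltry.
Qed.

End box_gauge_theory.

(** * Rational approximation in R^N *)

Section row_vectors.
Context {R : realType} {N : nat}.
Implicit Types x y : 'rV[R]_N.

Lemma rV_coord_le x i : `|x 0 i| <= `|x|.
Proof.
rewrite [leRHS]/Num.norm /= mx_normrE.
exact: (le_bigmax _ (fun ij : 'I_1 * 'I_N => `|x ij.1 ij.2|) (0, i)).
Qed.

Lemma rV_norm_lt x e : 0 < e -> (forall i, `|x 0 i| < e) -> `|x| < e.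
Proof.
move=> e0 xe; rewrite /Num.norm /= mx_normrE; apply/bigmax_ltP; split => //.
by case=> i j _ /=; rewrite (ord1 i).
Qed.

Definition ratrow (q : 'rV[rat]_N) : 'rV[R]_N := map_mx ratr q.

(** The radius may be taken [K + 1] times larger than the distance from the centre to [x]. [K = 0]
    serves to write open sets as unions of cubes; a larger [K] leaves room for the support of a
    cutoff. *)
Lemma open_ratrow_ball (A : set 'rV[R]_N) (K : nat) x : open A -> A x ->
  exists q m, `|ratrow q - x| < m.+1%:R^-1 /\
    forall y, `|ratrow q - y| < K.+1%:R / m.+1%:R -> A y.
Proof.
rewrite openE => /(_ x) /[apply] /nbhs_ballP[e /= e0 eA].
(* [K + 1] lengths [1 / (m + 1)] from [y] to the centre, and one more from the centre to [x]. *)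
have [m me] : exists m : nat, (K.+2)%:R / e < m.+1%:R.
  exists (Num.truncn ((K.+2)%:R / e)).
  by have /andP[] := truncn_itv (divr_ge0 (ler0n R K.+2) (ltW e0)).
have m0 : 0 < m.+1%:R^-1 :> R by rewrite invr_gt0.
have /choice[q qx] i : exists r : rat, x 0 i < ratr r < x 0 i + m.+1%:R^-1.
  have /rat_in_itvoo[r] : x 0 i < x 0 i + m.+1%:R^-1 by rewrite ltrDl.
  by rewrite in_itv; exists r.
exists (\row_i q i), m; split => [|y qy].
  apply: rV_norm_lt => // i; rewrite !mxE.
  by have /andP[? ?] := qx i; rewrite ger0_norm ?subr_ge0 1?ltW// ltrBlDl.
apply: eA; rewrite mx_norm_ball /ball_ /=.
have -> : x - y = (ratrow (\row_i q i) - y) - (ratrow (\row_i q i) - x).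
  by rewrite opprB [RHS]addrC addrA subrK.
apply: le_lt_trans (ler_normB _ _) _.
apply: (@lt_le_trans _ _ (K.+1%:R / m.+1%:R + m.+1%:R^-1)).
  apply: ltrD => //; apply: rV_norm_lt => // i; rewrite !mxE.
  by have /andP[? ?] := qx i; rewrite ger0_norm ?subr_ge0 1?ltW// ltrBlDl.
rewrite -[X in _ + X]mul1r -mulrDl -[X in _ + X]/(1%:R) -natrD addn1.
by rewrite ler_pdivrMr// mulrC -ler_pdivrMr// ltW.
Qed.

End row_vectors.

(** * Measurability of open sets *)

Section open_measurable.
Context {R : realType} {N : nat} (mu : {outer_measure set 'rV[R]_N -> \bar R}).
Local Notation M := (caratheodory_type mu).
Hypothesis halfspace : forall i c, mu.-caratheodory [set x : 'rV[R]_N | x 0 i <= c].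

Let measurable_coord i : measurable_fun [set: M] (fun x : M => (x : 'rV[R]_N) 0 i).
Proof.
move=> mT; apply: (measurability _ (RGenOInfty.measurableE R)) => // _ [_ [c ->] <-].
rewrite setTI (_ : _ @^-1` _ = ~` [set x : 'rV[R]_N | x 0 i <= c]).
  by apply: (@measurableC _ M); exact: halfspace.
by apply/seteqP; split => x /=; rewrite in_itv/= andbT ltNge => /negP.
Qed.

(** Sup-norm balls are cubes, that is, finite intersections of slabs, and an open set is the union
    of the countably many rational cubes it contains. Starting from half-spaces lets the lemma serve
    both Lebesgue and Hausdorff measure. *)
Lemma open_caratheodory (A : set 'rV[R]_N) : open A -> @measurable _ M A.
Proof.
move=> oA.
pose cube (qm : 'rV[rat]_N * nat) : set 'rV[R]_N :=
  [set x | `|ratrow qm.1 - x| < qm.2.+1%:R^-1].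
pose F k : set 'rV[R]_N := if unpickle k is Some qm then
  (if `[< cube qm `<=` A >] then cube qm else set0) else set0.
have -> : A = \bigcup_k F k.
  apply/seteqP; split => [x Ax|x [k _]]; rewrite /F.
    have [q [m [qx qA]]] := open_ratrow_ball 0 oA Ax.
    exists (pickle (q, m)) => //; rewrite pickleK ifT//.
    by apply/asboolP => y qy; apply: qA; rewrite mul1r.
  by case: unpickle => // qm; case: ifPn => // /asboolP; exact.
apply: (@bigcupT_measurable _ M) => k; rewrite /F; case: unpickle => [[q m]|];
  last exact: (@measurable0 _ M).
case: ifPn => _; last exact: (@measurable0 _ M).
have -> : cube (q, m) = \bigcap_(i in [set: 'I_N])
    [set x : 'rV[R]_N | ratr (q 0 i) - m.+1%:R^-1 < x 0 i < ratr (q 0 i) + m.+1%:R^-1].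
  apply/seteqP; split => [x /= qx i _ /=|x /= qx].
    by have := le_lt_trans (rV_coord_le _ i) qx; rewrite !mxE distrC ltr_distl.
  apply: rV_norm_lt => [|i]; first by rewrite invr_gt0.
  by rewrite !mxE distrC ltr_distl; exact: qx.
apply: (@fin_bigcap_measurable _ M) => // i _.
have := @measurable_coord i measurableT _ (measurable_itv
  `]ratr (q 0 i) - m.+1%:R^-1, ratr (q 0 i) + m.+1%:R^-1[).
by rewrite setTI set_itvoo; exact.
Qed.

Lemma within_continuous_measurable (A : set 'rV[R]_N) (f : 'rV[R]_N -> R) :
  {within A, continuous f} -> @measurable_fun _ _ M _ A f.
Proof.
move=> /continuousP cf mA; move: (mA).
apply: (@measurability _ _ M _ A f _ (RGenOpens.measurableE R)).
move=> _ [_ [a [b ->] <-]].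
have [V oV VE] := (@open_subspaceP _ _ _).1 (cf _ (@interval_open _ (BRight a) (BLeft b) isT isT)).
rewrite setIC -VE; apply: (@measurableI _ M) => //; exact: open_caratheodory.
Qed.

End open_measurable.

(** * Lower bound for the measure of a box *)

Section lebesgue_theory.
Context {R : realType} {N : nat}.
Implicit Types (a b c d x : 'rV[R]_N) (A : set 'rV[R]_N).

Let upd x (i : 'I_N) t : 'rV[R]_N := \row_j (if j == i then t else x 0 j).

Let interval_factor (s t : R) (y : R) : R := \1_(`]s, t]%classic : set R) y.

Let lebesgue_ocitv (s t : R) : lebesgue_measure (`]s, t]%classic : set R) =
  (if s%:E < t%:E then t%:E - s%:E else 0)%E.
Proof. exact: (lebesgue_measure_itv `]s, t]). Qed.

(* A cover of the box by boxes bounds its indicator by the sum of products of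
   interval indicators; integrating this bound over one coordinate at a time
   turns it into an inequality between volumes. *)
Lemma lebesgue_ocbox_ge c d : (forall i, c 0 i < d 0 i) ->
  ((box_volume c d)%:E <= lebesgue_outer (ocbox c d))%E.
Proof.
move=> cd; apply: le_ereal_inf_tmp => _ [A cdA <-].
have [[k Ak]|finA] := pselect (exists k, box_gauge (A k) = +oo%E).
  rewrite (_ : limn _ = +oo%E) ?leey//.
  by apply: eseries_pinfty Ak => // n _; rewrite gt_eqF// (lt_le_trans _ (box_gauge_ge0 _)).
(* [g k] consists of a factor and two corners. Empty covering sets get the factor 0, boxes the
   factor 1. *)
have /choice[g gP] k : exists g : R * ('rV[R]_N * 'rV[R]_N),
    [/\ 0 <= g.1,
     (forall x, A k x -> 1 <= g.1 * \prod_i interval_factor (g.2.1 0 i) (g.2.2 0 i) (x 0 i)) &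
     ((g.1 * \prod_i Num.max 0 (g.2.2 0 i - g.2.1 0 i))%:E <= box_gauge (A k))%E].
  have : box_gauge (A k) <> +oo%E by move=> Ak; apply: finA; exists k.
  case: (box_gaugeP (A k)) => [A0 _|a b x Aab Ax _|//]; last first.
  - exists (1, (a, b)); split => //= [y|].
      rewrite Aab mul1r => aby; rewrite big1// => i _.
      by rewrite /interval_factor indicE mem_set//= in_itv; exact: aby.
    rewrite mul1r lee_fin /box_volume; apply: ler_prod => i _.
    rewrite le_max lexx ge_max lexx andbT/= subr_ge0.
    by move: Ax; rewrite Aab => /(_ i)/andP[/ltW]; exact: le_trans.
  - by exists (0, (0, 0)); split => //= [y|]; rewrite ?mul0r// A0.
(* In [J k m] the coordinates before [m] have been integrated: their indicators are replaced by side
   lengths, while the others still depend on [x]. *)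
pose J k (m : nat) (x : 'rV[R]_N) := (g k).1 * \prod_(i < N) (if (i < m)%N then
  Num.max 0 ((g k).2.2 0 i - (g k).2.1 0 i)
  else interval_factor ((g k).2.1 0 i) ((g k).2.2 0 i) (x 0 i)).
have J0 k (m : nat) (x : 'rV[R]_N) : 0 <= J k m x.
  have [g0 _ _] := gP k; apply: mulr_ge0 => //; apply: prodr_ge0 => i _.
  by case: ifP => _; rewrite ?le_max ?lexx// /interval_factor indicE.
have JP m : (m <= N)%N -> forall x, ocbox c d x ->
    ((\prod_(i < N) (if (i < m)%N then d 0 i - c 0 i else 1))%:E <=
     \sum_(k <oo) (J k m x)%:E)%E.
  elim: m => [_ x cdx|m ih mN x cdx].
    rewrite big1//; have [k _ Akx] := cdA x cdx.
    have [_ /(_ _ Akx) Jk1 _] := gP k.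
    rewrite (@nneseriesD1 _ _ k)//; last by move=> *; rewrite lee_fin J0.
    apply: (@le_trans _ _ (J k 0 x)%:E); first by rewrite lee_fin.
    by rewrite leeDl// nneseries_ge0// => *; rewrite lee_fin J0.
  pose i0 := Ordinal mN.
  have ltS (i : 'I_N) : i != i0 -> (i < m.+1)%N = (i < m)%N.
    by move=> /negPf ii0; rewrite ltnS leq_eqVlt (inj_eq val_inj i i0) ii0.
  pose J' (k : nat) := (g k).1 * \prod_(i < N | i != i0) (if (i < m)%N then
    Num.max 0 ((g k).2.2 0 i - (g k).2.1 0 i)
    else interval_factor ((g k).2.1 0 i) ((g k).2.2 0 i) (x 0 i)).
  have J'0 k : 0 <= J' k.
    have [g0 _ _] := gP k; apply: mulr_ge0 => //; apply: prodr_ge0 => i _.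
    by case: ifP => _; rewrite ?le_max ?lexx// /interval_factor indicE.
  have JE k t : J k m (upd x i0 t) =
      J' k * interval_factor ((g k).2.1 0 i0) ((g k).2.2 0 i0) t.
    rewrite /J (bigD1 i0)//= ltnn mxE eqxx [X in _ * X]mulrC mulrA.
    congr (_ * _ * _); apply: eq_bigr => i /negPf ii0.
    by rewrite !mxE ii0.
  have JSE k : J k m.+1 x = J' k * Num.max 0 ((g k).2.2 0 i0 - (g k).2.1 0 i0).
    rewrite /J (bigD1 i0)//= ltnSn [X in _ * X]mulrC mulrA.
    congr (_ * _ * _); apply: eq_bigr => i ii0.
    by rewrite ltS.
  clearbody J'.
  pose C := \prod_(i < N | i != i0) (if (i < m)%N then d 0 i - c 0 i else 1).
  have -> : \prod_(i < N) (if (i < m.+1)%N then d 0 i - c 0 i else 1) = C * (d 0 i0 - c 0 i0).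
    rewrite (bigD1 i0)//= ltnSn mulrC; congr (_ * _).
    by apply: eq_bigr => i ii0; rewrite ltS.
  have CE : \prod_(i < N) (if (i < m)%N then d 0 i - c 0 i else 1) = C.
    by rewrite (bigD1 i0)//= ltnn mul1r.
  have leC t : c 0 i0 < t <= d 0 i0 -> (C%:E <= \sum_(k <oo)
      (J' k * interval_factor ((g k).2.1 0 i0) ((g k).2.2 0 i0) t)%:E)%E.
    move=> cdt; have := ih (ltnW mN) (upd x i0 t).
    rewrite CE// (eq_eseriesr (fun k _ => congr1 EFin (JE k t))); apply.
    by move=> j; rewrite mxE; case: eqP => [->//|_].
  pose cdi : set R := `]c 0 i0, d 0 i0]%classic.
  have mcdi : measurable cdi by exact: measurable_itv.
  (* The inequality of stage [m] is integrated over coordinate [m] alone, along that side of the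
     box. *)
  apply: (@le_trans _ _ (\int[lebesgue_measure]_(t in cdi) C%:E)%E).
    by rewrite integral_cst// /cdi/= lebesgue_ocitv lte_fin cd -EFinB -EFinM.
  pose f k t := interval_factor ((g k).2.1 0 i0) ((g k).2.2 0 i0) t.
  have f0 k t : 0 <= f k t by rewrite /f /interval_factor indicE.
  have mf k : measurable_fun cdi (fun t => (f k t)%:E).
    by apply/measurable_EFinP; apply: measurable_indic; exact: measurable_itv.
  have mJf k : measurable_fun cdi (fun t => (J' k * f k t)%:E).
    by under eq_fun do rewrite EFinM; exact: measurable_funeM.
  have Jf0 k t : (0 <= (J' k * f k t)%:E)%E by rewrite lee_fin mulr_ge0.
  apply: (@le_trans _ _ (\int[lebesgue_measure]_(t in cdi)
      (\sum_(k <oo) (J' k * f k t)%:E))%E).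
    apply: ge0_le_integral => //.
    - move=> t _; rewrite lee_fin; apply: prodr_ge0 => i _.
      by case: ifP => // _; rewrite subr_ge0 ltW.
    - by apply: (@ge0_emeasurable_sum _ _ _ _ (fun k t => (J' k * f k t)%:E) xpredT).
  rewrite integral_nneseries//.
  apply: lee_nneseries => [k _ _|k _]; first exact: integral_ge0.
  under eq_integral do rewrite EFinM.
  rewrite ge0_integralZl_EFin//; last 2 first.
  - by move=> t _; rewrite lee_fin.
  - exact: mf.
  rewrite JSE EFinM; apply: lee_wpmul2l; first by rewrite lee_fin.
  rewrite integral_indic//.
  apply: (@le_trans _ _ (lebesgue_measure (`](g k).2.1 0 i0, (g k).2.2 0 i0]%classic : set R))).
    by apply: le_measure; rewrite ?inE//; exact: measurableI.
  rewrite /= lebesgue_ocitv lte_fin; case: ifPn => [_|].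
    by rewrite -EFinB lee_fin le_max lexx orbT.
  by rewrite lee_fin le_max lexx.
(* All coordinates are integrated, so any point of the box will do; the upper corner [d] belongs to
   it. *)
have := JP N (leqnn N) d; rewrite (eq_bigr (fun i => d 0 i - c 0 i)); last first.
  by move=> i _; rewrite ltn_ord.
move=> /(_ _)/le_trans; apply.
  by move=> i; rewrite cd lexx.
apply: lee_nneseries => k _; first by rewrite lee_fin.
have [_ _] := gP k; apply: le_trans; rewrite lee_fin le_eqVlt /J; apply/orP; left.
by apply/eqP; congr (_ * _); apply: eq_bigr => i _; rewrite ltn_ord.
Qed.
End lebesgue_theory.

(** * Hausdorff measure *)

Section metric_outer_measure.
Context {R : realType} {T : Type} (mu : {outer_measure set T -> \bar R}).
Local Open Scope ereal_scope.

(* Caratheodory's criterion for the sublevel sets of one function: [X] above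
   level [c] is exhausted by the sets above [c + a k], up to the rings [r j],
   [k <= j], whose total measure is finite as [r j] is separated from the set
   above [c + a j]. *)
Lemma caratheodory_sublevel (f : T -> R) (c : R) :
  (forall (X Y : set T) (s t : R), (s < t)%R -> (forall x, X x -> (f x <= s)%R) ->
     (forall y, Y y -> (t < f y)%R) -> mu X + mu Y <= mu (X `|` Y)) ->
  mu.-caratheodory [set x | (f x <= c)%R].
Proof.
move=> mu_sep; apply: le_caratheodory_measurable => X /=.
set H := [set x | (f x <= c)%R].
have [->|Xoo] := eqVneq (mu X) +oo; first by rewrite leey.
pose a (k : nat) : R := (k.+1%:R^-1)%R.
have a_decr k : (a k.+1 < a k)%R by rewrite ltf_pV2 ?posrE// ltr_nat.
have a0 k : (0 < a k)%R by rewrite invr_gt0.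
pose B k := X `&` [set x | (c + a k < f x)%R].
pose r k := X `&` [set x | (c + a k.+2 < f x <= c + a k.+1)%R].
have BX k : mu (B k) <= mu X by apply: le_outer_measure => x [].
have XBoo k : mu (X `&` H) + mu (B k) <= mu X.
  apply: (@le_trans _ _ (mu (X `&` H `|` B k))).
    apply: (mu_sep _ _ c (c + a k)%R); first by rewrite ltrDl.
      by move=> x [].
    by move=> x [].
  by apply: le_outer_measure => x [[]|[]].
(* The ring [r n] and the set [B n] are separated by the gap between the levels [c + a n.+1] and
   [c + a n], and both lie in [B n.+2]. Keeping two consecutive terms on the right treats rings of
   even and odd index in one induction. *)
have sum_r n : \sum_(0 <= k < n) mu (r k) <= mu (B n) + mu (B n.+1).
  elim: n => [|n ih]; first by rewrite big_nil adde_ge0// outer_measure_ge0.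
  rewrite big_nat_recr//=; apply: (le_trans (leeD2r _ ih)).
  rewrite addeAC [X in _ <= X]addeC; apply: leeD => //; rewrite addeC.
  apply: (@le_trans _ _ (mu (r n `|` B n))).
    apply: (mu_sep _ _ (c + a n.+1)%R (c + a n)%R); first by rewrite ltrD2l.
      by move=> x [_ /andP[]].
    by move=> x [].
  apply: le_outer_measure => x [[Xx /andP[xc _]]|[Xx xc]]; split => //=.
  by apply: lt_trans xc; rewrite ltrD2l (lt_trans (a_decr _)).
have r_lty : \sum_(k <oo) mu (r k) < +oo.
  apply: (@le_lt_trans _ _ (mu X + mu X)); last first.
    by rewrite lte_add_pinfty// ltey.
  apply: lime_le.
    by apply: is_cvg_nneseries => *; exact: outer_measure_ge0.
  by apply: nearW => n; apply: (le_trans (sum_r n)); exact: leeD.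
have tail := nneseries_tail_cvg r_lty (fun k _ => outer_measure_ge0 mu (r k)).
have key k : mu (X `&` H) + mu (X `&` ~` H) <= mu X + \sum_(k <= j <oo) mu (r j).
  apply: (@le_trans _ _ (mu (X `&` H) + (mu (B k.+1) + \sum_(k <= j <oo) mu (r j)))).
    apply: leeD => //.
    apply: (@le_trans _ _ (mu (B k.+1 `|` \bigcup_(j in ~` `I_k) r j))).
      apply: le_outer_measure => x [Xx /negP]; rewrite -ltNge => cx.
      have [xk|kx] := ltP (c + a k.+1)%R (f x); [by left|right].
      have ex : exists j, (c + a j < f x)%R.
        exists (Num.truncn (f x - c)^-1); rewrite addrC -ltrBrDr.
        rewrite -[X in (_ < X)%R]invrK ltf_pV2 ?posrE ?invr_gt0 ?subr_gt0//.
        have /truncn_itv/andP[_ //] : (0 <= (f x - c)^-1)%R.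
        by rewrite invr_ge0 subr_ge0 ltW.
      (* For the least such [j] the point lies in the ring of index [j - 2]: above the level
         [c + a j], but not above the preceding one. *)
      have [j jx jmin] := ex_minnP ex.
      have kj : (k.+1 < j)%N.
        rewrite ltnNge; apply/negP => jk; move: kx; rewrite leNgt => /negP; apply.
        apply: le_lt_trans jx; rewrite lerD2l lef_pV2 ?posrE// ler_nat.
        by rewrite ltnS.
      case: j jx jmin kj => // -[//|j] jx jmin kj.
      exists j; first by apply/negP; rewrite -leqNgt -ltnS -ltnS.
      split => //=; rewrite jx/= leNgt; apply/negP => /jmin.
      by rewrite ltnn.
    apply: (le_trans (outer_measureU2 _ _ _)); apply: leeD => //.
    exact: outer_measure_sigma_subadditive_tail.
  by rewrite addeA; apply: leeD.
rewrite -[leRHS]adde0; have /cvge_to_ge : (mu X + \sum_(k <= j <oo) mu (r j)) @[k --> \oo] --> mu X + 0.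
  apply: (cvgeD _ (cvg_cst _) tail).
  by rewrite fin_num_adde_defr// ge0_fin_numE ?outer_measure_ge0// ltey.
by apply; exact: nearW.
Qed.

End metric_outer_measure.

Section hausdorff_theory.
Context {R : realType} (N s : nat).
Implicit Types X Y : set 'rV[R]_N.

Lemma coord_le_enorm (x : 'rV[R]_N) i : `|x 0 i| <= enorm x.
Proof.
rewrite -sqrtr_sqr /enorm ler_wsqrtr// /dotv (bigD1 i)//= -expr2 lerDl.
by apply: sumr_ge0 => j _; rewrite -expr2 sqr_ge0.
Qed.

(** Once the diameter bound is below [e], no set of finite gauge meets both [X] and [Y], so a cover
    of the union splits into two covers. *)
Lemma hausdorff_outerD X Y (e : R) : 0 < e ->
  (forall x y, X x -> Y y -> e <= enorm (x - y)) ->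
  (hausdorff_outer s X + hausdorff_outer s Y <= hausdorff_outer s (X `|` Y))%E.
Proof.
move=> e0 XYe.
have gauge_ge0 (d : R) (A : set 'rV[R]_N) : (0 <= hausdorff_gauge s d A)%E.
  rewrite /hausdorff_gauge; case: ifPn => // /set0P[x Ax].
  case: ifP => // _; apply: mule_ge0; first exact: outer_measure_ge0.
  apply: expe_ge0; apply: (@le_trans _ _ (enorm (x - x))%:E).
    by rewrite lee_fin sqrtr_ge0.
  by apply: ereal_sup_ubound; exists (x, x).
have gauge_le (d d' : R) (A : set 'rV[R]_N) : d <= d' ->
    (gauge_outer (hausdorff_gauge s d') A <= gauge_outer (hausdorff_gauge s d) A)%E.
  move=> dd'; apply: le_ereal_inf_tmp => _ [F AF <-].
  apply: (@le_trans _ _ (\sum_(k <oo) hausdorff_gauge s d' (F k))%E).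
    by apply: ge_ereal_inf; eexists; last exact: lexx; exists F.
  apply: lee_nneseries => // k _; rewrite /hausdorff_gauge; case: ifPn => // _.
  case: ifPn => [_|nd']; first by case: ifPn => // _; rewrite leey.
  case: ifPn => // dd; move: nd'; rewrite (le_trans dd)//.
have gaugeD (d : R) : d < e ->
    (gauge_outer (hausdorff_gauge s d) X + gauge_outer (hausdorff_gauge s d) Y <=
     gauge_outer (hausdorff_gauge s d) (X `|` Y))%E.
  move=> de; apply: gauge_outerD_le => // E.
  have gauge0 : hausdorff_gauge s d (set0 : set 'rV[R]_N) = 0%E by rewrite /hausdorff_gauge eqxx.
  have [EX0|/set0P[x [Ex Xx]]] := eqVneq (E `&` X) set0.
    by exists set0, E; rewrite EX0 gauge0 add0e; split => // x [].
  have [EY0|/set0P[y [Ey Yy]]] := eqVneq (E `&` Y) set0.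
    by exists E, set0; rewrite EY0 gauge0 adde0; split => // ? [].
  (* A set meeting both has diameter at least [e], hence infinite gauge, and may be used in both
     covers. *)
  exists E, E; split => [? []//|? []//|].
  rewrite [X in (_ <= X)%E]/hausdorff_gauge ifF; last by apply/eqP => E0; rewrite E0 in Ex.
  rewrite ifF ?leey//; apply/negbTE; rewrite -ltNge.
  apply: (@lt_le_trans _ _ e%:E); first by rewrite lte_fin.
  apply: (@le_trans _ _ (enorm (x - y))%:E); first by rewrite lee_fin XYe.
  by apply: ereal_sup_ubound; exists (x, y).
(* The two suprema on the left involve unrelated diameter bounds; a common smaller bound handles
   both, since the outer measure grows as the bound decreases. *)
have gaugeH (d d' : R) : 0 < d -> 0 < d' ->
    (gauge_outer (hausdorff_gauge s d) X + gauge_outer (hausdorff_gauge s d') Y <=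
     hausdorff_outer s (X `|` Y))%E.
  move=> d0 d'0; pose m := Num.min (Num.min d d') (e / 2).
  have m0 : 0 < m by rewrite !lt_min d0 d'0/= divr_gt0.
  apply: (@le_trans _ _ (gauge_outer (hausdorff_gauge s m) (X `|` Y))); last first.
    by apply: ereal_sup_ubound; exists m.
  apply: (@le_trans _ _ (gauge_outer (hausdorff_gauge s m) X +
      gauge_outer (hausdorff_gauge s m) Y)%E).
    by apply: leeD; apply: gauge_le; rewrite !ge_min lexx ?orbT.
  apply: gaugeD; apply: (@le_lt_trans _ _ (e / 2)).
    by rewrite ge_min lexx orbT.
  by rewrite ltr_pdivrMr// mulr_natr mulr2n ltrDl.
have [->|XYoo] := eqVneq (hausdorff_outer s (X `|` Y)) +oo%E; first by rewrite leey.
have XY_fin : hausdorff_outer s (X `|` Y) \is a fin_num.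
  by rewrite ge0_fin_numE ?ltey//; exact: (outer_measure_ge0 (hausdorff_om R N s)).
have fin A : A `<=` X `|` Y -> hausdorff_outer s A \is a fin_num.
  move=> AXY; rewrite ge0_fin_numE; last exact: (outer_measure_ge0 (hausdorff_om R N s)).
  apply: (@le_lt_trans _ _ (hausdorff_outer s (X `|` Y))).
    exact: (le_outer_measure (hausdorff_om R N s)).
  by rewrite ltey.
have X_fin := fin X (@subsetUl _ _ _); have Y_fin := fin Y (@subsetUr _ _ _).
(* The suprema are removed one after the other; finiteness allows the remaining term to be moved
   across the inequality. *)
rewrite addeC -leeBrDr//; apply: ge_ereal_sup => _ [d' d'0 <-].
rewrite leeBrDr// addeC -leeBrDr//; last first.
  rewrite ge0_fin_numE; last exact: gauge_outer_ge0.
  apply: (@le_lt_trans _ _ (hausdorff_outer s Y)); last by rewrite ltey_eq Y_fin.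
  by apply: ereal_sup_ubound; exists d'.
apply: ge_ereal_sup => _ [d d0 <-].
rewrite leeBrDr//; first exact: gaugeH.
rewrite ge0_fin_numE; last exact: gauge_outer_ge0.
apply: (@le_lt_trans _ _ (hausdorff_outer s Y)); last by rewrite ltey_eq Y_fin.
by apply: ereal_sup_ubound; exists d'.
Qed.

(** Coordinates are 1-Lipschitz for [enorm], so sets separated by two levels of a coordinate are at
    positive distance and Caratheodory's criterion applies. *)
Lemma hausdorff_halfspace (i : 'I_N) (c : R) :
  (hausdorff_om R N s).-caratheodory [set x : 'rV[R]_N | x 0 i <= c].
Proof.
apply: (caratheodory_sublevel (f := fun x : 'rV[R]_N => x 0 i)) => X Y u t ut Xu Yt.
apply: (@hausdorff_outerD _ _ (t - u)); first by rewrite subr_gt0.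
move=> x y /Xu xu /Yt yt; apply: le_trans (coord_le_enorm _ i).
rewrite !mxE distrC ger0_norm; first by rewrite lerB// ltW.
by rewrite subr_ge0 (le_trans xu)// ltW// (lt_trans ut).
Qed.

End hausdorff_theory.

(** * Lebesgue integral on R^N *)

Section lebesgue_measure_rV.
Context {R : realType} {N : nat}.
Implicit Types A D : set 'rV[R]_N.
Local Notation leb := (lebesgue_rV R N).
Local Notation LM := (caratheodory_type (@lebesgue_om R N)).

Lemma open_lebesgue_measurable A : open A -> @measurable _ LM A.
Proof. exact/open_caratheodory/lebesgue_halfspace. Qed.

Lemma continuous_lebesgue_measurable D (f : 'rV[R]_N -> R) : open D ->
  (forall x, D x -> {for x, continuous f}) -> @measurable_fun _ _ LM _ D f.
Proof.
move=> oD cf; apply: within_continuous_measurable.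
  exact: lebesgue_halfspace.
by rewrite continuous_open_subspace// => x /set_mem; exact: cf.
Qed.

Lemma bounded_lebesgue_lty A : bounded_set A -> (leb A < +oo)%E.
Proof.
move=> [M [_ AM]]; pose b : 'rV[R]_N := \row_i (M + 1).
apply: (@le_lt_trans _ _ (lebesgue_outer (ocbox (- b) b))); last first.
  exact: lebesgue_ocbox_lty.
apply: (le_outer_measure (@lebesgue_om R N)) => x Ax i.
have : `|x| <= M + 2^-1 by apply: AM => //; rewrite ltrDl.
move/(le_trans (rV_coord_le x i)); rewrite ler_norml !mxE => /andP[xl xr].
by apply/andP; split; lra.
Qed.

(** A point of [A] would have a cube of positive volume around it in [A]. This is what turns an
    almost everywhere statement about the continuous gradient into an everywhere one. *)
Lemma open_null_eq0 A : open A -> leb A = 0%E -> A = set0.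
Proof.
move=> oA A0; apply/seteqP; split => // x Ax.
move: (oA); rewrite openE => /(_ x Ax) /nbhs_ballP[e /= e0 eA].
pose c : 'rV[R]_N := \row_i (x 0 i - e / 2); pose d : 'rV[R]_N := \row_i (x 0 i + e / 2).
have e2 : 0 < e / 2 by rewrite divr_gt0.
have cdA : ocbox c d `<=` A.
  move=> y cdy; apply: eA; rewrite mx_norm_ball /ball_ /=.
  apply: rV_norm_lt => // i; have := cdy i; rewrite !mxE => /andP[yl yr].
  by rewrite ltr_norml; apply/andP; split; lra.
have cd i : c 0 i < d 0 i by rewrite !mxE; lra.
have := lebesgue_ocbox_ge cd.
move/le_trans => /(_ _ (le_outer_measure (@lebesgue_om R N) _ _ cdA)).
rewrite [X in (_ <= X)%E]A0 lee_fin leNgt => /negP; apply.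
by apply: prodr_gt0 => i _; rewrite subr_gt0.
Qed.

(** The Caratheodory condition for the preimage, tested on [X], is that of [A] tested on a translate
    of [X]. *)
Let shift_measurable h : measurable_fun [set: LM] (shift h : LM -> LM).
Proof.
move=> _ A mA; rewrite setTI.
suff : (@lebesgue_om R N).-caratheodory (shift h @^-1` A) by [].
have {}mA : (@lebesgue_om R N).-caratheodory A := mA.
move=> X.
have e B : lebesgue_om N B = lebesgue_om N (shift (- h) @^-1` B :> set 'rV[R]_N).
  by rewrite /= lebesgue_translate.
rewrite e mA [X in _ = (X + _)%E]e [X in _ = (_ + X)%E]e.
congr (_ + _)%E; congr (lebesgue_om N _); apply/seteqP; split => x /=;
  by rewrite subrK.
Qed.

Lemma integral_translate h (f : 'rV[R]_N -> \bar R) :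
  leb.-integrable setT f ->
  (\int[leb]_x f (x + h)%R = \int[leb]_x f x)%E.
Proof.
move=> intf.
have mf := measurable_int _ intf.
have int_pos (g : LM -> \bar R) : measurable_fun setT g -> (forall x, 0 <= g x)%E ->
    (\int[leb]_x g (x + h)%R = \int[leb]_x g x)%E.
  move=> mg g0.
  transitivity (\int[pushforward leb (shift h : LM -> LM)]_x g x)%E.
    by rewrite (ge0_integral_pushforward (shift_measurable h)).
  by apply: eq_measure_integral => A mA _; exact: lebesgue_translate.
rewrite integralE [RHS]integralE; congr (_ - _)%E.
  rewrite -(int_pos _ (measurable_funepos mf) (funepos_ge0 f)).
  by apply: eq_integral => x _; rewrite !funeposE.
rewrite -(int_pos _ (measurable_funeneg mf) (funeneg_ge0 f)).
by apply: eq_integral => x _; rewrite !funenegE.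
Qed.

End lebesgue_measure_rV.

Section bounded_convergence.
Context d {T : measurableType d} {R : realType} (mu : {measure set T -> \bar R}).

Lemma bounded_integrable (D : set T) (f : T -> R) (C : R) : measurable D ->
  (mu D < +oo)%E -> measurable_fun D f -> (forall x, D x -> `|f x| <= C) ->
  mu.-integrable D (EFin \o f).
Proof.
move=> mD Doo mf fC; apply: measurable_bounded_integrable => //.
exists C; split; first exact: num_real.
by move=> M CM x Dx; apply: (le_trans (fC x Dx)); exact: ltW.
Qed.

Lemma dominated_cvg_integral (D : set T) (f_ : nat -> T -> R) (f g : T -> R) :
  measurable D -> (forall k, measurable_fun D (f_ k)) -> measurable_fun D f ->
  (forall x, D x -> f_ ^~ x @ \oo --> f x) ->
  mu.-integrable D (EFin \o g) ->
  (forall k x, D x -> `|f_ k x| <= g x) ->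
  (\int[mu]_(x in D) (f_ k x)%:E)%E @[k --> \oo] -->
  (\int[mu]_(x in D) (f x)%:E)%E.
Proof.
move=> mD mf_ mf f_f ig f_g.
have [|||||_ _ //] := @dominated_convergence _ _ _ mu _ mD
  (fun k => EFin \o f_ k) (EFin \o f) (EFin \o g).
- by move=> k; exact/measurable_EFinP.
- exact/measurable_EFinP.
- by apply: aeW => x Dx; apply: cvg_EFin; [exact: nearW|exact: f_f].
- exact: ig.
- by apply: aeW => x k Dx; rewrite lee_fin f_g.
Qed.

End bounded_convergence.

(** * Functions of class C^1 *)

Lemma near_eq_continuous (T U : topologicalType) (f g : T -> U) x :
  {near x, f =1 g} -> {for x, continuous f} -> {for x, continuous g}.
Proof.
move=> fg cf; rewrite /prop_for /continuous_at -(nbhs_singleton fg).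
by apply: cvg_trans cf; exact: near_eq_cvg.
Qed.

Section locality.
Context {R : realType} {V W : normedModType R}.

Lemma near_eq_differentiable (f g : V -> W) a :
  {near a, f =1 g} -> differentiable f a -> differentiable g a.
Proof.
move=> fg df.
have sub0 : (g - f) \o shift a = cst ((g - f) a) + (\0 : V -> W) +o_ 0 id.
  apply/eqaddoP => _/posnumP[e].
  have : \forall x \near 0, f (x + a) = g (x + a).
    have /= := @near_shift _ _ 0 a (fun x => f x = g x).
    by rewrite subr0 => <-.
  have fga := nbhs_singleton fg.
  apply: filterS => x fgx /=.
  rewrite -[(_ - _) x]/((g - f) (x + a) - ((g - f) a + 0)).
  rewrite -![(g - f) _]/(g _ - f _) fgx fga !subrr addr0 subrr normr0.
  by rewrite mulr_ge0.
have d0 : 'd (g - f) a = (\0 : V -> W) :> (V -> W).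
  by apply: diff_unique => //; exact: cst_continuous.
have -> : g = (g - f) + f by rewrite subrK.
apply: differentiableD => //; apply/diff_locallyP; rewrite d0; split => //.
exact: cst_continuous.
Qed.

End locality.

Section C1_functions.
Context {R : realType} {N : nat}.
Implicit Types (D : set 'rV[R]_N) (f g : 'rV[R]_N -> R) (x : 'rV[R]_N).

Lemma near_eq_gradient f g x :
  {near x, f =1 g} -> gradient f x = gradient g x.
Proof. by move=> fg; apply/rowP => i; rewrite !mxE; exact: near_eq_derive. Qed.

Lemma gradient_cst (k : R) x : gradient (cst k) x = 0.
Proof. by apply/rowP => i; rewrite !mxE derive_cst. Qed.

Lemma gradientM f g x : differentiable f x -> differentiable g x ->
  gradient (f * g) x = f x *: gradient g x + g x *: gradient f x.
Proof.
move=> df dg; apply/rowP => i; rewrite !mxE !deriveE//; last exact: differentiableM.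
by rewrite diffM.
Qed.

Lemma gradientD f g x : differentiable f x -> differentiable g x ->
  gradient (f + g) x = gradient f x + gradient g x.
Proof.
move=> df dg; apply/rowP => i; rewrite !mxE !deriveE//; last exact: differentiableD.
by rewrite diffD.
Qed.

Lemma gradient_comp (phi : R -> R) f x : differentiable f x ->
  derivable phi (f x) 1 ->
  gradient (phi \o f) x = derive1 phi (f x) *: gradient f x.
Proof.
move=> df /derivable1_diffP dphi; apply/rowP => i.
rewrite !mxE !deriveE//; last exact: differentiable_comp.
by rewrite diff_comp//= diff1E//= mulrC.
Qed.

Lemma derive_translate (h v x : 'rV[R]_N) f :
  'D_v (f \o shift h) x = 'D_v f (x + h).
Proof.
rewrite /derive; have -> // : (fun t : R => t^-1 *: (((f \o shift h) \o shift x) (t *: v) -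
    (f \o shift h) x)) = (fun t => t^-1 *: ((f \o shift (x + h)) (t *: v) - f (x + h))).
by apply/funext => t /=; rewrite addrA.
Qed.

Lemma differentiable_translate (h x : 'rV[R]_N) f :
  differentiable f (x + h) -> differentiable (f \o shift h) x.
Proof.
move=> df; exact: (differentiable_comp (g := f)).
Qed.

Lemma C1_on_eq D f g : open D -> (forall x, D x -> f x = g x) ->
  C1_on D f -> C1_on D g.
Proof.
move=> oD fg [df cf].
have nfg x : D x -> {near x, f =1 g}.
  by move=> Dx; apply: filterS (open_nbhs_nbhs (conj oD Dx)) => y /fg.
split=> x Dx; first exact: near_eq_differentiable (nfg x Dx) (df x Dx).
apply: near_eq_continuous (cf x Dx).
apply: filterS (open_nbhs_nbhs (conj oD Dx)) => y Dy.
exact: near_eq_gradient (nfg y Dy).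
Qed.

Lemma C1_onS D D' f : D `<=` D' -> C1_on D' f -> C1_on D f.
Proof. by move=> DD' [df cf]; split => x /DD'; [exact: df|exact: cf]. Qed.

Lemma C1_onU D D' f : C1_on D f -> C1_on D' f -> C1_on (D `|` D') f.
Proof.
by move=> [df cf] [df' cf']; split => x [];
  [exact: df|exact: df'|exact: cf|exact: cf'].
Qed.

Lemma C1_on_continuous D f x : C1_on D f -> D x -> {for x, continuous f}.
Proof. by move=> [df _] Dx; exact: (differentiable_continuous (df x Dx)). Qed.

Lemma C1_on_gradient_continuous D f i x :
  C1_on D f -> D x -> {for x, continuous (fun y => gradient f y 0 i)}.
Proof.
move=> [_ cf] Dx.
apply: (@continuous_comp _ _ _ (gradient f) (fun M : 'rV[R]_N => M 0 i)).
  exact: cf.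
exact: coord_continuous.
Qed.

Lemma C1_on_cst D (k : R) : C1_on D (cst k).
Proof.
split=> x _; first exact: differentiable_cst.
have -> : gradient (cst k) = cst 0 :> ('rV[R]_N -> 'rV[R]_N).
  by apply/funext => y; rewrite gradient_cst.
exact: cst_continuous.
Qed.

Let continuous_gradient_eq D f (G : 'rV[R]_N -> 'rV[R]_N) x : open D ->
  (forall y, D y -> gradient f y = G y) -> D x -> {for x, continuous G} ->
  {for x, continuous (gradient f)}.
Proof.
move=> oD fG Dx; apply: near_eq_continuous.
by apply: filterS (open_nbhs_nbhs (conj oD Dx)) => y /fG.
Qed.

Lemma C1_onM D f g : open D -> C1_on D f -> C1_on D g -> C1_on D (f * g).
Proof.
move=> oD Cf Cg; have [[df cf] [dg cg]] := (Cf, Cg).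
split=> x Dx; first exact: differentiableM (df x Dx) (dg x Dx).
apply: (continuous_gradient_eq oD (fun y Dy => gradientM (df y Dy) (dg y Dy)) Dx).
apply: (@continuousD _ _ _ (fun y => f y *: gradient g y) (fun y => g y *: gradient f y)).
  by apply: continuousZ; [exact: C1_on_continuous Cf Dx|exact: cg].
by apply: continuousZ; [exact: C1_on_continuous Cg Dx|exact: cf].
Qed.

Lemma C1_onD D f g : open D -> C1_on D f -> C1_on D g -> C1_on D (f + g).
Proof.
move=> oD Cf Cg; have [[df cf] [dg cg]] := (Cf, Cg).
split=> x Dx; first exact: differentiableD (df x Dx) (dg x Dx).
apply: (continuous_gradient_eq oD (fun y Dy => gradientD (df y Dy) (dg y Dy)) Dx).
by apply: (@continuousD _ _ _ (gradient f) (gradient g)); [exact: cf|exact: cg].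
Qed.

Lemma C1_on_sum D n (f : 'I_n -> 'rV[R]_N -> R) : open D ->
  (forall i, C1_on D (f i)) -> C1_on D (fun x => \sum_i f i x).
Proof.
move=> oD; elim: n f => [|n ih] f Cf.
  apply: (C1_on_eq oD _ (C1_on_cst D 0)) => x _; by rewrite big_ord0.
apply: (C1_on_eq oD _ (C1_onD oD (Cf ord0) (ih (fun i => f (lift ord0 i)) _))) => //.
by move=> x _; rewrite big_ord_recl.
Qed.

Lemma C1_on_comp D (phi phi' : R -> R) f : open D ->
  (forall s : R, is_derive s 1 phi (phi' s)) -> continuous phi' ->
  C1_on D f -> C1_on D (phi \o f).
Proof.
move=> oD dphi cphi Cf; have [df cf] := Cf.
have dphi1 s : derivable phi s 1 by have [] := dphi s.
split=> x Dx.
  apply: differentiable_comp; first exact: df.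
  by apply/derivable1_diffP; exact: dphi1.
apply: (continuous_gradient_eq oD (fun y Dy => gradient_comp (df y Dy) (dphi1 _)) Dx).
apply: continuousZ; last exact: cf.
have -> : (fun y => derive1 phi (f y)) = phi' \o f.
  by apply/funext => y /=; rewrite derive1E; have [_ ->] := dphi (f y).
by apply: continuous_comp; [exact: (C1_on_continuous Cf)|exact: cphi].
Qed.

Lemma C1_on_coord D i : open D -> C1_on D (fun x => x 0 i).
Proof.
move=> oD; split=> x _; first exact: differentiable_coord.
have gE y : gradient (fun x : 'rV[R]_N => x 0 i) y = delta_mx 0 i.
  apply/rowP => j; rewrite !mxE.
  have := derive_mx (@derivable_id _ _ y (delta_mx 0 j : 'rV[R]_N)).
  rewrite derive_id => /matrixP/(_ 0 i); rewrite !mxE => <-.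
  by rewrite !eqxx/= eq_sym.
have -> : gradient (fun x : 'rV[R]_N => x 0 i) = cst (delta_mx 0 i).
  exact/funext.
exact: cst_continuous.
Qed.

Lemma C1_on_translate D h f :
  C1_on D f -> C1_on (shift h @^-1` D) (f \o shift h).
Proof.
move=> [df cf]; split => x Dx; first exact/differentiable_translate/df.
have -> : gradient (f \o shift h) = gradient f \o shift h.
  by apply/funext => y; apply/rowP => i; rewrite !mxE derive_translate.
apply: (@continuous_comp _ _ _ (shift h) (gradient f)); last exact: cf.
apply: (@continuousD _ _ _ id (cst h)); first by move=> ?.
exact: cst_continuous.
Qed.

End C1_functions.

Section difference_quotient.
Context {R : realType} {N : nat}.
Implicit Types (f : 'rV[R]_N -> R) (x v : 'rV[R]_N).

(** Mean value theorem on the segment from [x] to [x + h v]. The hypotheses bear on this segment, so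
    that functions differentiable just on an open set are covered. *)
Lemma difference_quotient_le f x v (h C : R) : 0 < h ->
  (forall t, 0 <= t <= h -> differentiable f (x + t *: v) /\ `|'D_v f (x + t *: v)| <= C) ->
  `|h^-1 * (f (x + h *: v) - f x)| <= C.
Proof.
move=> h0 fC; pose g t := f (x + t *: v).
have dg (t : R) : 0 <= t <= h -> is_derive t 1 g ('D_v f (x + t *: v)).
  move=> th; have [df _] := fC t th.
  have qE : (fun s : R => s^-1 *: ((g \o shift t) (s *: 1) - g t)) =
      (fun s : R => s^-1 *: ((f \o shift (x + t *: v)) (s *: v) - f (x + t *: v))).
    apply/funext => s /=; congr (_ *: (f _ - _)).
    by rewrite (_ : s *: 1 = s) ?scalerDl 1?addrCA//; exact: mulr1.
  have Df := @diff_derivable _ _ _ f _ v df.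
  by split; rewrite /derivable /derive qE.
have [||t] := @MVT R g (fun t => 'D_v f (x + t *: v)) 0 h h0.
- by move=> t; rewrite in_itv/= => /andP[/ltW t0 /ltW th]; apply: dg; rewrite t0 th.
- apply: derivable_within_continuous => t; rewrite in_itv/= => /dg; by case.
rewrite in_itv/= => /andP[t0 th]; rewrite /g scale0r addr0 subr0 => ->.
rewrite mulrCA mulVf ?gt_eqF// mulr1.
by have [|_ ] := fC t; first by rewrite !ltW.
Qed.

Lemma difference_quotient_cvg f x v (h : nat -> R) :
  differentiable f x -> (forall k, h k != 0) -> h @ \oo --> 0 ->
  ((h k)^-1 * (f (x + h k *: v) - f x)) @[k --> \oo] --> 'D_v f x.
Proof.
move=> df h_neq0 h0; have /cvgr_dnbhsP := @diff_derivable _ _ _ f x v df.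
have -> : (fun k => (h k)^-1 * (f (x + h k *: v) - f x)) =
  (fun t : R => t^-1 *: ((f \o shift x) (t *: v) - f x)) \o h.
  by apply/funext => k /=; rewrite [x + _]addrC.
by apply.
Qed.

End difference_quotient.

(** * Integration by parts *)

Section compact_support.
Context {R : realType} {N : nat}.
Implicit Types (D S : set 'rV[R]_N) (f g : 'rV[R]_N -> R) (x y : 'rV[R]_N).
Local Notation leb := (lebesgue_rV R N).
Local Notation LM := (caratheodory_type (@lebesgue_om R N)).

(** Each point of [S] has a ball in [D], and compactness makes one radius serve them all. The margin
    leaves room for translating a support. *)
Lemma compact_margin S D : compact S -> open D -> S `<=` D ->
  exists2 d, 0 < d & forall x y, S x -> `|x - y| <= d -> D y.
Proof.
move=> /compact_near_coveringP cS oD SD.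
have : \forall d \near 0^'+, S `<=` [set x | forall y, `|x - y| <= d -> D y].
  apply: (cS _ (0 : R)^'+ (fun d x => forall y, `|x - y| <= d -> D y)) => x Sx.
  move: (oD); rewrite openE => /(_ x (SD _ Sx)) /nbhs_ballP[e /= e0 eD].
  have e2 : 0 < e / 2 by rewrite divr_gt0.
  exists (ball x (e / 2), [set d | d < e / 2]) => /=.
    by split; [exact: nbhsx_ballx|exact: nbhs_right_lt].
  move=> [z d] /= [xz de] y zy; apply: eD.
  move: xz; rewrite mx_norm_ball /ball_ /= => xz.
  rewrite (splitr e) -(subrK z x) -addrA; apply: le_lt_trans (ler_normD _ _) _.
  by rewrite ltrD// (le_lt_trans zy).
move=> near_d; near (0 : R)^'+ => d.
have d0 : 0 < d by near: d; exact: nbhs_right_gt.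
exists d => // x y Sx; apply: (near near_d d) => //.
Unshelve. all: by end_near. Qed.

Lemma compact_norm_le S f : compact S -> (forall x, S x -> {for x, continuous f}) ->
  exists2 C, 0 <= C & forall x, S x -> `|f x| <= C.
Proof.
move=> cS cf; have : compact (f @` S).
  apply: continuous_compact => //; apply: continuous_in_subspaceT => x /set_mem.
  exact: cf.
move=> /compact_bounded[M [_ MS]]; exists (`|M| + 1); first by rewrite addr_ge0.
move=> x Sx; apply: MS; last by exists x.
by rewrite (le_lt_trans (ler_norm M))// ltrDl.
Qed.

Lemma bounded_support_integrable D (B : set 'rV[R]_N) f (C : R) : open D -> open B ->
  bounded_set B -> (forall x, D x -> {for x, continuous f}) ->
  (forall x, D x -> `|f x| <= C) -> (forall x, D x -> ~ B x -> f x = 0) ->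
  leb.-integrable D (EFin \o f).
Proof.
move=> oD oB bB cf fC f0; have mD := open_lebesgue_measurable oD.
have oDB : open (D `&` B) by exact: openI.
have mDB := open_lebesgue_measurable oDB.
apply/(integrable_mkcond _ mD).
have -> : (EFin \o f) \_ D = (EFin \o f) \_ (D `&` B).
  apply/funext => x; rewrite /patch; case: ifPn => [/set_mem Dx|nDx].
    case: ifPn => // nB; rewrite /= f0// => Bx.
    by move: nB; rewrite in_setI !mem_set.
  by rewrite ifF//; apply/negbTE; rewrite in_setI (negbTE nDx).
apply/(integrable_mkcond _ mDB); apply: (bounded_integrable (C := C)) => //.
- apply: (le_lt_trans (le_outer_measure (@lebesgue_om R N) _ _ (@subIsetr _ D B))).
  exact: bounded_lebesgue_lty.
- by apply: continuous_lebesgue_measurable => // x [Dx _]; exact: cf.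
- by move=> x [Dx _]; exact: fC.
Qed.

Lemma compact_support_integrable D S f : open D -> compact S -> S `<=` D ->
  (forall x, D x -> {for x, continuous f}) -> (forall x, D x -> ~ S x -> f x = 0) ->
  leb.-integrable D (EFin \o f).
Proof.
move=> oD cS SD cf f0.
have [C C0 fC] := compact_norm_le cS (fun x Sx => cf x (SD x Sx)).
have [M [_ MS]] := compact_bounded cS.
apply: (@bounded_support_integrable D (ball 0 (`|M| + 2)) f C) => //.
- exact: ball_open.
- exists (`|M| + 2); split; first exact: num_real.
  move=> r Mr x /=; rewrite mx_norm_ball /ball_ /= sub0r normrN => /ltW xM.
  exact: (le_trans xM (ltW Mr)).
- move=> x Dx; have [/fC//|nS] := pselect (S x).
  by rewrite f0// normr0.
- move=> x Dx nBx; apply: f0 => // Sx; apply: nBx.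
  rewrite mx_norm_ball /ball_ /= sub0r normrN (@le_lt_trans _ _ (`|M| + 1))//.
    by apply: MS => //; rewrite (le_lt_trans (ler_norm M))// ltrDl.
  by rewrite ltrD2l ltr1n.
Qed.

End compact_support.

Section integration_by_parts.
Context {R : realType} {N : nat}.
Implicit Types (D S : set 'rV[R]_N) (f phi psi : 'rV[R]_N -> R) (x : 'rV[R]_N).
Local Notation leb := (lebesgue_rV R N).
Local Notation LM := (caratheodory_type (@lebesgue_om R N)).
Local Notation supp f := (closure [set x | f x != 0]).

Lemma not_supp f x : ~ supp f x -> f x = 0.
Proof.
by move=> sx; apply/eqP/negPn/negP => fx; apply: sx; exact: subset_closure.
Qed.

Lemma near_not_supp f x : ~ supp f x -> {near x, f =1 cst 0}.
Proof.
move=> sx; have : open_nbhs x (~` supp f).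
  by split => //; apply: closed_openC; exact: closed_closure.
by move/open_nbhs_nbhs; apply: filterS => y; exact: not_supp.
Qed.

Lemma gradient_not_supp f x : ~ supp f x -> gradient f x = 0.
Proof. by move/near_not_supp/near_eq_gradient ->; rewrite gradient_cst. Qed.

Lemma test_functionS D D' phi : D `<=` D' -> test_function D phi ->
  test_function D' phi.
Proof. by move=> DD' [C1 cS SD]; split => //; exact: subset_trans DD'. Qed.

(** The product is C^1 everywhere although [f] is so on [D]: the space is the union of [D] and of
    the open complement of the support of [phi], where the product is 0. *)
Lemma test_functionM D f phi : open D -> C1_on D f -> test_function D phi ->
  test_function D (f * phi).
Proof.
move=> oD Cf [Cphi cS SD].
have S_sub : supp (f * phi) `<=` supp phi.
  apply: closureS => x /=; apply: contra_neq => phi0.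
  by rewrite -[LHS]/(f x * phi x) phi0 mulr0.
have oS : open (~` supp phi) by apply: closed_openC; exact: closed_closure.
split.
- have -> : [set: 'rV[R]_N] = D `|` ~` supp phi.
    apply/seteqP; split => // x _; have [/SD|] := pselect (supp phi x);
      [by left|by right].
  apply: C1_onU; first exact: C1_onM oD Cf (C1_onS (@subsetT _ _) Cphi).
  apply: (C1_on_eq oS _ (C1_on_cst _ 0)) => x /not_supp phi0.
  by rewrite -[RHS]/(f x * phi x) phi0 mulr0.
- apply: (subclosed_compact _ cS S_sub); exact: closed_closure.
- exact: subset_trans SD.
Qed.

Let integral_support (B : set LM) (f : LM -> R) : (forall x, ~ B x -> f x = 0) ->
  (\int[leb]_x (f x)%:E = \int[leb]_(x in B) (f x)%:E)%E.
Proof.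
move=> f0; rewrite [RHS]integral_mkcond; apply: eq_integral => x _.
rewrite /patch; case: ifPn => // /negP nBx; rewrite f0// => Bx.
by apply: nBx; rewrite inE.
Qed.

(* The integral of a difference quotient vanishes, by translation invariance. *)
Lemma integral_gradient_eq0 psi i : test_function setT psi ->
  (\int[leb]_x (gradient psi x 0 i)%:E = 0)%E.
Proof.
move=> [Cpsi cS _]; pose e_i : 'rV[R]_N := delta_mx 0 i.
have cgrad x : {for x, continuous (fun y => gradient psi y 0 i)}.
  exact: C1_on_gradient_continuous Cpsi _.
have cpsi x : {for x, continuous psi} by exact: C1_on_continuous Cpsi _.
have [C C0 gradC] := compact_norm_le cS (fun x _ => cgrad x).
have {}gradC x : `|gradient psi x 0 i| <= C.
  have [/gradC//|/gradient_not_supp ->] := pselect (supp psi x).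
  by rewrite mxE normr0.
have [M [_ MS]] := compact_bounded cS.
have {}MS x : supp psi x -> `|x| <= `|M| + 1.
  by move=> Sx; apply: MS => //; rewrite (le_lt_trans (ler_norm M))// ltrDl.
(* The support lies within radius [|M| + 1] and the steps are at most 1, so all difference quotients
   vanish outside this ball. *)
pose B := ball (0 : 'rV[R]_N) (`|M| + 3).
have BP x : B x <-> `|x| < `|M| + 3.
  by rewrite /B mx_norm_ball /ball_ /= sub0r normrN.
have oB : open B by exact: ball_open.
have bB : bounded_set B.
  exists (`|M| + 3); split; first exact: num_real.
  by move=> r Mr x /= /BP/ltW xM; exact: (le_trans xM (ltW Mr)).
pose q k x := (@harmonic R k)^-1 * (psi (x + harmonic k *: e_i) - psi x).
have h0 k : 0 < @harmonic R k by rewrite /harmonic/= invr_gt0.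
have psi_shift k x : {for x, continuous (fun x => psi (x + harmonic k *: e_i))}.
  apply: (@continuous_comp _ _ _ (shift (harmonic k *: e_i)) psi) => //.
  by apply: (@continuousD _ _ _ id (cst (harmonic k *: e_i))) => //; exact: cst_continuous.
have cq k x : {for x, continuous (q k)}.
  apply: (@continuousM _ _ (cst (harmonic k)^-1)); first exact: cst_continuous.
  exact: continuousB.
have qC k x : `|q k x| <= C.
  apply: difference_quotient_le => // t _.
  have [df _] := Cpsi; split; first exact: df.
  by have := gradC (x + t *: e_i); rewrite mxE.
have e1 : `|e_i| <= 1.
  by rewrite /Num.norm/= mx_normrE; apply/bigmax_leP; split => // -[a b] _ /=;
    rewrite mxE; case: (_ && _); rewrite ?normr1 ?normr0.
have q0 k x : ~ B x -> q k x = 0.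
  move=> /BP/negP; rewrite -leNgt => xM; rewrite /q !not_supp ?subrr ?mulr0//.
    by move=> /MS; apply/negP; rewrite -ltNge; lra.
  move=> /MS; apply/negP; rewrite -ltNge.
  have : `|x| <= `|x + harmonic k *: e_i| + `|harmonic k *: e_i|.
    by rewrite -{1}(addrK (harmonic k *: e_i) x) ler_normB.
  have : `|harmonic k *: e_i| <= 1.
    rewrite normrZ gtr0_norm// mulr_ile1 ?(ltW (h0 k))//.
    by rewrite /harmonic/= invf_le1// ler1n.
  by move: xM; lra.
have ipsi : leb.-integrable setT (EFin \o psi).
  by apply: (compact_support_integrable openT cS) => // x _ /not_supp.
have iq k : leb.-integrable setT (EFin \o q k).
  exact: (bounded_support_integrable openT oB bB (fun x _ => cq k x)
    (fun x _ => qC k x) (fun x _ => @q0 k x)).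
(* The translate of [psi] is [harmonic k * q k + psi]; it has the same finite integral as [psi],
   which cancels. *)
have iq0 k : (\int[leb]_x (q k x)%:E = 0)%E.
  have := integral_translate (harmonic k *: e_i) ipsi.
  under eq_integral => x _.
    have -> : (EFin \o psi) (x + harmonic k *: e_i) =
        ((harmonic k)%:E * (q k x)%:E + (psi x)%:E)%E.
      by rewrite -EFinM -EFinD /q mulrA mulfV ?gt_eqF// mul1r subrK.
    over.
  rewrite (integralD measurableT (integrableZl measurableT (harmonic k) (iq k)) ipsi).
  rewrite (integralZl measurableT (iq k)).
  move: (integrable_fin_num measurableT (iq k)) (integrable_fin_num measurableT ipsi).
  move=> /fineK <- /fineK <-; rewrite -EFinM -EFinD => -[] /eqP.
  by rewrite -subr_eq0 addrK mulf_eq0 gt_eqF//= => /eqP ->.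
rewrite (integral_support (B := B)); last first.
  move=> x /BP/negP; rewrite -leNgt => xM; rewrite gradient_not_supp ?mxE//.
  by move=> /MS; apply/negP; rewrite -ltNge; lra.
have mB := open_lebesgue_measurable oB.
(* The dominating function is the constant [C], integrable because [B] has finite measure. *)
have := @dominated_cvg_integral _ LM R leb B q (fun x => gradient psi x 0 i)
  (cst C) mB.
move=> /(_ _ _ _ _ _)/cvg_lim <-//.
- rewrite (_ : (fun k => _) = cst 0%E) ?lim_cst//; apply/funext => k.
  rewrite -(iq0 k) [in RHS](integral_support (B := B))// => x nBx.
  by rewrite q0.
- by move=> k; apply: continuous_lebesgue_measurable => // x _.
- by apply: continuous_lebesgue_measurable => // x _.
- move=> x _; rewrite mxE; apply: difference_quotient_cvg.
  + by have [df _] := Cpsi; exact: df.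
  + by move=> k; rewrite gt_eqF.
  + exact: cvg_harmonic.
- apply: (bounded_integrable (C := C)) => //; first exact: bounded_lebesgue_lty.
  by move=> x _; rewrite ger0_norm.
Qed.

End integration_by_parts.

(** [f * phi] is a test function, so its partial derivatives have integral 0; the product rule
    splits this into two integrals, both finite by the compact support of [phi]. *)
Lemma C1_weak_gradient (R : realType) n (D : set 'rV[R]_n.+1) f : open D -> C1_on D f -> weak_gradient D f (gradient f).
Proof.
move=> oD Cf phi tphi i; have tpsi := test_functionM oD Cf tphi.
have mD := open_lebesgue_measurable oD.
have [Cphi cS SD] := tphi.
have cf x : D x -> {for x, continuous f} by move=> Dx; exact: C1_on_continuous Cf Dx.
have cphi x : {for x, continuous phi} by exact: C1_on_continuous Cphi _.
have int1 : (lebesgue_rV R n.+1).-integrable D (fun x => (f x * gradient phi x 0 i)%:E).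
  apply: (compact_support_integrable oD cS SD) => [x Dx|x _ /gradient_not_supp ->].
    apply: continuousM; first exact: cf.
    exact: C1_on_gradient_continuous Cphi _.
  by rewrite mxE mulr0.
have int2 : (lebesgue_rV R n.+1).-integrable D (fun x => (gradient f x 0 i * phi x)%:E).
  apply: (compact_support_integrable oD cS SD) => [x Dx|x _ /not_supp ->].
    apply: continuousM; last exact: cphi.
    exact: C1_on_gradient_continuous Cf Dx.
  by rewrite mulr0.
have := integral_gradient_eq0 i (test_functionS (@subsetT _ D) tpsi).
rewrite (_ : (\int[lebesgue_rV R n.+1]_x _)%E = (\int[lebesgue_rV R n.+1]_(x in D)
    ((f x * gradient phi x 0 i)%:E + (gradient f x 0 i * phi x)%:E))%E); last first.
  rewrite [RHS]integral_mkcond; apply: eq_integral => x _; rewrite /patch.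
  case: ifPn => [/set_mem Dx|/negP nDx].
    rewrite gradientM; first by rewrite !mxE EFinD; congr (_ + _%:E)%E; rewrite mulrC.
      by case: Cf => + _; exact.
    by case: Cphi => + _; exact.
  rewrite gradient_not_supp ?mxE//.
  by case: tpsi => _ _ SD' /SD' Dx; apply: nDx; rewrite inE.
rewrite integralD//; move: (integrable_fin_num mD int1) (integrable_fin_num mD int2).
move=> /fineK <- /fineK <-; rewrite -EFinD -EFinN => -[] /eqP.
by rewrite addr_eq0 => /eqP ->.
Qed.

(** * Cutoff functions *)

Section ramp.
Context {R : realType}.

(** A C^1 substitute for the positive part, with derivative [2 max(0, s)]. It truncates the pressure
    and is also the building block of the cutoffs. *)
Definition ramp (s : R) : R := Num.max 0 s ^+ 2.

Lemma ramp_le0 s : s <= 0 -> ramp s = 0.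
Proof. by move=> s0; rewrite /ramp max_l// expr0n. Qed.

Lemma ramp_ge0E s : 0 <= s -> ramp s = s ^+ 2.
Proof. by move=> s0; rewrite /ramp max_r. Qed.

Lemma ramp_ge0 s : 0 <= ramp s.
Proof. exact: sqr_ge0. Qed.

(** The derivative is 2-Lipschitz, whence a remainder bound uniform in [s]: the point 0 gets no
    special treatment in [is_derive_ramp]. *)
Lemma ramp_taylor s h : `|ramp (h + s) - ramp s - 2 * Num.max 0 s * h| <= h ^+ 2.
Proof.
have [s0|s0] := leP s 0; have [hs0|hs0] := leP (h + s) 0.
- by rewrite !ramp_le0// mulr0 mul0r !subr0 normr0 sqr_ge0.
- rewrite (ramp_ge0E (ltW hs0)) (ramp_le0 s0) mulr0 mul0r !subr0.
  by rewrite ger0_norm ?sqr_ge0//; nra.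
- rewrite (ramp_le0 hs0) (ramp_ge0E (ltW s0)) ler_norml; apply/andP; split; nra.
- rewrite (ramp_ge0E (ltW hs0)) (ramp_ge0E (ltW s0)) ler_norml; apply/andP; split; nra.
Qed.

Lemma is_derive_ramp (s : R) : is_derive s 1 ramp (2 * Num.max 0 s).
Proof.
have cvg_quot : (fun h : R => h^-1 *: ((ramp \o shift s) (h *: 1) - ramp s)) @ 0^' -->
    2 * Num.max 0 s.
  apply/cvgrPdist_le => e e0; near=> h.
  have h0 : h != 0 by near: h; exact: nbhs_dnbhs_neq.
  have he : `|h| <= e by near: h; exact: dnbhs0_le.
  apply: le_trans he; rewrite /= (_ : h *: 1 = h); last exact: mulr1.
  rewrite distrC -(ler_pM2l (_ : 0 < `|h|)) ?normr_gt0// -normrM.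
  apply: le_trans (_ : h ^+ 2 <= _); last by rewrite -expr2 real_normK ?num_real.
  apply: le_trans (ramp_taylor s h); rewrite le_eqVlt; apply/orP; left; apply/eqP.
  congr (`|_|); rewrite mulrBr [h * (2 * _)]mulrC; congr (_ - _).
  exact: mulVKf.
by split; [apply/cvg_ex; eexists; exact: cvg_quot|exact: cvg_lim cvg_quot].
Unshelve. all: by end_near. Qed.

Lemma continuous_ramp' : continuous (fun s : R => 2 * Num.max 0 s).
Proof.
move=> s; have cmax : {for s, continuous (cst 0 \max id : R -> R)}.
  by apply: continuous_max; [exact: cst_continuous|move=> ?].
exact: (cvgM (cvg_cst _) cmax).
Qed.

Lemma C1_on_ramp N (D : set 'rV[R]_N) f : open D -> C1_on D f ->
  C1_on D (fun x => ramp (f x)).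
Proof.
move=> oD; exact: (C1_on_comp oD is_derive_ramp continuous_ramp').
Qed.

End ramp.

Section cutoff.
Context {R : realType} {N : nat}.
Implicit Types (D : set 'rV[R]_N) (x c : 'rV[R]_N).
Local Notation supp f := (closure [set x | f x != 0]).

Lemma test_function0 D : test_function D (cst 0 : 'rV[R]_N -> R).
Proof.
split; first exact: C1_on_cst.
  rewrite (_ : [set _ | _] = set0) ?closure0; first exact: compact0.
  by apply/seteqP; split => // x /=; rewrite eqxx.
rewrite (_ : [set _ | _] = set0) ?closure0//.
by apply/seteqP; split => // x /=; rewrite eqxx.
Qed.

Lemma test_functionD D (f g : 'rV[R]_N -> R) :
  test_function D f -> test_function D g -> test_function D (f + g).
Proof.
move=> [Cf cf fD] [Cg cg gD].
have sub : supp (f + g) `<=` supp f `|` supp g.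
  rewrite -closureU; apply: closureS => x /= fg.
  have [f0|] := eqVneq (f x) 0; last by left.
  right; apply: contra_neq fg => g0.
  by rewrite -[LHS]/(f x + g x) f0 g0 addr0.
split.
- by apply: C1_onD => //; exact: openT.
- apply: (subclosed_compact _ _ sub); first exact: closed_closure.
  exact: compactU.
- by move=> x /sub[/fD|/gD].
Qed.

Lemma dotv_ge_norm x : `|x| ^+ 2 <= dotv x x.
Proof.
have d0 : 0 <= dotv x x by apply: sumr_ge0 => i _; rewrite -expr2 sqr_ge0.
rewrite -[leRHS]sqr_sqrtr// ler_sqr ?nnegrE//.
rewrite /Num.norm/= mx_normrE; apply/bigmax_leP; split => // -[a i] _ /=.
by rewrite (ord1 a); exact: coord_le_enorm.
Qed.

Lemma dotv_le_norm x : dotv x x <= N%:R * `|x| ^+ 2.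
Proof.
rewrite /dotv; apply: le_trans (_ : \sum_(i < N) `|x| ^+ 2 <= _).
  by apply: ler_sum => i _; rewrite -expr2 -real_normK ?num_real// ler_sqr ?nnegrE// rV_coord_le.
by rewrite sumr_const card_ord mulr_natl.
Qed.

(** With [t = |x - c|^2 / r^2] for the Euclidean norm, the inner ramp is at least 1 for [t <= 1] and
    0 for [t >= 2]; the outer [1 - ramp (1 - u)] maps 0 to 0 and every [u >= 1] to 1. The Euclidean
    square is a polynomial, hence C^1, unlike the sup norm. *)
Definition bump c (r : R) x : R :=
  1 - ramp (1 - ramp (2 - r ^- 2 * dotv (x - c) (x - c))).

Lemma bump_itv c r x : 0 <= bump c r x <= 1.
Proof.
rewrite /bump; set u := ramp (2 - _); have u0 : 0 <= u by exact: ramp_ge0.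
have [v0|v0] := leP (1 - u) 0; first by rewrite ramp_le0//; apply/andP; split; lra.
by rewrite ramp_ge0E ?(ltW v0)//; apply/andP; split; nra.
Qed.

Lemma bump_eq1 c r x : 0 < r -> dotv (x - c) (x - c) <= r ^+ 2 -> bump c r x = 1.
Proof.
move=> r0 xr; rewrite /bump.
have : r ^- 2 * dotv (x - c) (x - c) <= 1.
  by rewrite mulrC ler_pdivrMr ?exprn_gt0// mul1r.
set u := _ * _ => u1; rewrite [ramp (1 - _)]ramp_le0 ?subr0//.
rewrite ramp_ge0E; first nra; lra.
Qed.

Lemma bump_neq0 c r x : 0 < r -> bump c r x != 0 -> `|x - c| <= 2 * r.
Proof.
move=> r0; apply: contra_neqT; rewrite -ltNge => xc; rewrite /bump.
have : 2 <= r ^- 2 * dotv (x - c) (x - c).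
  rewrite mulrC ler_pdivlMr ?exprn_gt0//; apply: le_trans (dotv_ge_norm _).
  apply: (@le_trans _ _ ((2 * r) ^+ 2)).
    by rewrite exprMn ler_wpM2r ?sqr_ge0// -natrX ler_nat.
  by rewrite ler_sqr ?nnegrE ?normr_ge0 ?mulr_ge0 ?(ltW r0)// ltW.
set u := _ * _ => u2; rewrite [ramp (2 - _)]ramp_le0; last lra.
by rewrite subr0 ramp_ge0E// expr1n subrr.
Qed.

Lemma C1_on_bump c r : C1_on setT (bump c r).
Proof.
have C1B1 (f : 'rV[R]_N -> R) (k a : R) : C1_on setT f -> C1_on setT (fun x => k + a * f x).
  move=> Cf; apply: (@C1_onD _ _ _ (cst k) (cst a * f)) => //; first exact: openT.
    exact: C1_on_cst.
  by apply: C1_onM => //; [exact: openT|exact: C1_on_cst].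
have C1r (f : 'rV[R]_N -> R) : C1_on setT f -> C1_on setT (fun x => 1 - ramp (f x)).
  move=> /(C1_on_ramp openT)/C1B1 => /(_ 1 (-1)); apply: C1_on_eq; first exact: openT.
  by move=> x _; rewrite mulN1r.
apply: (C1r (fun x => 1 - ramp (2 - r ^- 2 * dotv (x - c) (x - c)))).
apply: (C1r (fun x => 2 - r ^- 2 * dotv (x - c) (x - c))).
apply: (@C1_on_eq _ _ _ (fun x => 2 + (- r ^- 2) * dotv (x - c) (x - c))).
- exact: openT.
- by move=> x _; rewrite mulNr.
apply: C1B1; rewrite /dotv; apply: C1_on_sum; first exact: openT.
move=> i; have Ci : C1_on setT (fun x : 'rV[R]_N => (x - c) 0 i).
  apply: (C1_on_eq openT _ (@C1_on_translate _ _ setT (- c) _ (C1_on_coord i openT))).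
  by [].
by apply: C1_onM => //; exact: openT.
Qed.

Lemma test_function_bump D c r : 0 < r ->
  (forall y, `|y - c| <= 2 * r -> D y) -> test_function D (bump c r).
Proof.
move=> r0 Dc; have sub : supp (bump c r) `<=` [set y | `|y - c| <= 2 * r].
  have /closure_id -> : closed [set y : 'rV[R]_N | `|y - c| <= 2 * r].
    rewrite (_ : [set _ | _] = closed_ball_ Num.norm c (2 * r)).
      exact: closed_closed_ball_.
    by apply/seteqP; split => y; rewrite /closed_ball_ /= distrC.
  by apply: closureS => x; exact: bump_neq0.
split; first exact: C1_on_bump.
  apply: bounded_closed_compact; last exact: closed_closure.
  exists (`|c| + 2 * r); split; first exact: num_real.
  move=> M cM x /sub /= xc; apply: le_trans (ltW cM).
  have -> : x = c + (x - c) by rewrite addrC subrK.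
  by apply: le_trans (ler_normD _ _) _; rewrite lerD2l.
by move=> x /sub; exact: Dc.
Qed.

(** Bumps on countably many rational balls are accumulated so that [1 - eta k] is the product of the
    [1 - b j] over [j < k]. The values thus increase within [0, 1] and stay equal to 1 once a bump
    equal to 1 has been used. *)
Lemma exists_cutoff D : open D ->
  exists eta : nat -> 'rV[R]_N -> R,
    [/\ forall k, test_function D (eta k),
        forall k x, 0 <= eta k x <= 1,
        forall k x, eta k x <= eta k.+1 x &
        forall x, D x -> \forall k \near \oo, eta k x = 1].
Proof.
(* A bump of radius [r = (N + 1) / (m + 1)] lives within distance [2 r], which is less than
   [(K + 1) / (m + 1)]. *)
move=> oD; pose K := N.+1.*2.
have K0 (m : nat) : 0 < N.+1%:R / m.+1%:R :> R by rewrite divr_gt0.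
pose good (qm : 'rV[rat]_N * nat) :=
  `[< forall y, `|ratrow qm.1 - y| < K.+1%:R / qm.2.+1%:R -> D y >].
pose b j : 'rV[R]_N -> R := if unpickle j is Some qm then
  (if good qm then bump (ratrow qm.1) (N.+1%:R / qm.2.+1%:R) else cst 0) else cst 0.
have tb j : test_function D (b j).
  rewrite /b; case: unpickle => [qm|]; last exact: test_function0.
  case: ifPn => [/asboolP gqm|_]; last exact: test_function0.
  apply: test_function_bump => // y yq; apply: gqm; rewrite distrC.
  apply: (le_lt_trans yq); rewrite mulrA ltr_pM2r ?invr_gt0//.
  by rewrite -natrM ltr_nat /K mul2n.
have b01 j x : 0 <= b j x <= 1.
  rewrite /b; case: unpickle => [qm|]; last by rewrite lexx ler01.
  by case: ifPn => _; [exact: bump_itv|rewrite lexx ler01].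
pose eta := fix eta (k : nat) : 'rV[R]_N -> R :=
  if k is k'.+1 then eta k' + (cst 1 - eta k') * b k' else cst 0.
have etaS k x : eta k.+1 x = eta k x + (1 - eta k x) * b k x by [].
have eta01 k x : 0 <= eta k x <= 1.
  elim: k => [|k /andP[e0 e1]]; first by rewrite lexx ler01.
  by have /andP[b0 b1] := b01 k x; rewrite etaS; apply/andP; split; nra.
exists eta; split => //.
- elim=> [|k ih]; first exact: test_function0.
  apply: test_functionD => //; apply: test_functionM => //.
  have [Ce _ _] := ih.
  apply: (@C1_on_eq _ _ _ (cst 1 + cst (-1) * eta k)) => //.
    move=> x _; rewrite -[LHS]/(1 + -1 * eta k x) mulN1r//.
  apply: C1_onD => //; first exact: C1_on_cst.
  by apply: C1_onM => //; [exact: C1_on_cst|exact: C1_onS Ce].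
- move=> k x; have /andP[b0 b1] := b01 k x; have /andP[e0 e1] := eta01 k x.
  by rewrite etaS; nra.
- move=> x Dx; have [q [m [qx qD]]] := open_ratrow_ball K oD Dx.
  have bx : b (pickle (q, m)) x = 1.
    rewrite /b pickleK ifT; last exact/asboolP.
    (* [x] is within [1 / (m + 1)] of the centre in sup norm, so its squared Euclidean distance is
       at most [N / (m + 1)^2], below the squared radius. *)
    apply: bump_eq1 => //=; apply: le_trans (dotv_le_norm _) _.
    rewrite distrC exprMn.
    have : `|ratrow q - x| ^+ 2 <= (m.+1%:R^-1) ^+ 2.
      by rewrite ler_sqr ?nnegrE ?invr_ge0// ltW.
    move=> /(ler_wpM2l (ler0n R N))/le_trans; apply.
    apply: ler_wpM2r; first exact: sqr_ge0.
    rewrite -natrX ler_nat (leq_trans (leqnSn N))// -{1}(expn1 N.+1).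
    exact: leq_pexp2l.
  exists (pickle (q, m)).+1 => // k /= /subnK <-.
  elim: (k - _)%N => [|j ih].
    by rewrite add0n etaS bx mulr1 addrC subrK.
  by rewrite addSn etaS ih subrr mul0r addr0.
Qed.

End cutoff.

(** * Square integrability of the gradient *)

Section gradient_L2.
Context {R : realType} {N : nat}.
Implicit Types (D S : set 'rV[R]_N) (f g eta : 'rV[R]_N -> R) (x : 'rV[R]_N).
Local Notation leb := (lebesgue_rV R N).
Local Notation LM := (caratheodory_type (@lebesgue_om R N)).
Local Notation supp f := (closure [set x | f x != 0]).

(* The difference quotients [q k] of a C^1 function are themselves C^1, so
   [q k * eta] is a test function; it converges to [gradient f * eta]. *)
Lemma cutoff_difference_quotients D f eta (i : 'I_N) : open D -> C1_on D f ->
  test_function D eta -> (forall x, 0 <= eta x <= 1) ->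
  exists2 phi : nat -> 'rV[R]_N -> R, forall k, test_function D (phi k) &
  exists2 C : R, 0 <= C &
    [/\ forall x, D x -> phi k x @[k --> \oo] --> gradient f x 0 i * eta x,
        forall k x, `|phi k x| <= C,
        forall x, supp eta x -> `|gradient f x 0 i| <= C &
        forall k x, ~ supp eta x -> phi k x = 0].
Proof.
move=> oD Cf teta eta01; have [Ceta cS SD] := teta.
have [d d0 dD] := compact_margin cS oD SD.
pose e_i : 'rV[R]_N := delta_mx 0 i.
have e1 : `|e_i| <= 1.
  by rewrite /Num.norm/= mx_normrE; apply/bigmax_leP; split => // -[a b] _ /=;
    rewrite mxE; case: (_ && _); rewrite ?normr1 ?normr0.
have te t : 0 <= t <= d -> `|t *: e_i| <= d.
  move=> /andP[t0 td]; rewrite normrZ ger0_norm// -[leRHS]mulr1.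
  exact: ler_pM.
have shD x t : supp eta x -> 0 <= t <= d -> D (x + t *: e_i).
  move=> Sx td; apply: dD Sx _; rewrite opprD addrA subrr add0r normrN.
  exact: te.
pose h k := d * @harmonic R k.
have h0 k : 0 < h k by rewrite mulr_gt0// invr_gt0.
have hd k : h k <= d by rewrite ger_pMr// /harmonic/= invf_le1// ler1n.
pose q k x := (h k)^-1 * (f (x + h k *: e_i) - f x).
have [C C0 gradC] : exists2 C : R, 0 <= C &
    forall x t, supp eta x -> 0 <= t <= d -> `|gradient f (x + t *: e_i) 0 i| <= C.
  (* The set swept out by the support of [eta] under displacements up to the margin [d]: a compact
     subset of [D], on which the gradient is bounded. *)
  pose T := (fun xt : 'rV[R]_N * R => xt.1 + xt.2 *: e_i) @` (supp eta `*` `[0, d]).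
  have cT : compact T.
    apply: continuous_compact; last first.
      by apply: compact_setX => //; exact: segment_compact.
    apply: continuous_subspaceT => xt.
    apply: (@continuousD _ _ _ fst (fun xt : 'rV[R]_N * R => xt.2 *: e_i)).
      exact: cvg_fst.
    apply: continuousZ; [exact: cvg_snd|exact: cst_continuous].
  have TD y : T y -> D y.
    by move=> [[x t] /= [Sx]]; rewrite in_itv => td <-; exact: shD.
  have [C C0 TC] := compact_norm_le cT
    (fun y Ty => @C1_on_gradient_continuous _ _ _ _ i _ Cf (TD y Ty)).
  exists C => // x t Sx td; apply: TC; by exists (x, t).
exists (fun k => q k * eta) => [k|].
  (* Both terms of the quotient are C^1 on [Dk], which still contains the support of [eta] because
     the step is at most [d]. *)
  pose Dk := D `&` shift (h k *: e_i) @^-1` D.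
  have oDk : open Dk.
    apply: openI => //; apply: open_comp => // x _.
    by apply: (@continuousD _ _ _ id (cst _)) => //; exact: cst_continuous.
  apply: (@test_functionS _ _ Dk); first by move=> x [].
  apply: test_functionM => //.
    have CD : C1_on Dk (fun x => f (x + h k *: e_i) - f x).
      apply: (@C1_on_eq _ _ _ ((f \o shift (h k *: e_i)) + cst (-1) * f)) => //.
        by move=> x _; rewrite -[LHS]/(f (x + h k *: e_i) + -1 * f x) mulN1r.
      apply: C1_onD => //.
        by apply: (@C1_onS _ _ _ (shift (h k *: e_i) @^-1` D)) => [x []//|]; exact: C1_on_translate.
      apply: C1_onM => //; first exact: C1_on_cst.
      by apply: C1_onS Cf => x [].
    exact: (C1_onM oDk (C1_on_cst _ _) CD).
  split => // x Sx; split; first exact: SD.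
  by apply: shD => //; rewrite hd ltW.
exists C => //; split.
- move=> x Dx; apply: cvgMl.
  rewrite mxE; apply: difference_quotient_cvg.
  + by have [df _] := Cf; exact: df.
  + by move=> k; rewrite gt_eqF.
  + rewrite -(mulr0 d); apply: cvgMr; exact: cvg_harmonic.
- move=> k x; have [Sx|nSx] := pselect (supp eta x); last first.
    by rewrite -[X in `|X|]/(q k x * eta x) (not_supp nSx) mulr0 normr0.
  rewrite -[X in `|X|]/(q k x * eta x) normrM -[leRHS]mulr1 ler_pM//; last first.
    by have /andP[? ?] := eta01 x; rewrite ger0_norm.
  apply: difference_quotient_le => // t /andP[t0 th].
  have td : 0 <= t <= d by rewrite t0 (le_trans th).
  have [df _] := Cf; split; first exact/df/shD.
  by have := gradC x t Sx td; rewrite mxE.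
- by move=> x Sx; have := gradC x 0 Sx; rewrite scale0r addr0 lexx ltW//; exact.
- by move=> k x nSx; rewrite -[LHS]/(q k x * eta x) (not_supp nSx) mulr0.
Qed.

(** Write [f'] for the partial derivative. Testing with difference quotients and passing to the
    limit, the integrals of [f'^2 eta] and [g f' eta] agree. The latter is at most half that of
    [g^2] plus half that of [f'^2 eta]; this last term is finite by compact support and is
    absorbed. *)
Lemma cutoff_gradient_le D f g eta (i : 'I_N) :
  open D -> (leb D < +oo)%E -> C1_on D f ->
  @measurable_fun _ _ LM _ D g -> leb.-integrable D (fun x => (g x ^+ 2)%:E) ->
  (forall phi, test_function D phi ->
    (\int[leb]_(x in D) (g x * phi x)%:E =
     \int[leb]_(x in D) (gradient f x 0 i * phi x)%:E)%E) ->
  test_function D eta -> (forall x, 0 <= eta x <= 1) ->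
  (\int[leb]_(x in D) (gradient f x 0 i ^+ 2 * eta x)%:E <=
   \int[leb]_(x in D) (g x ^+ 2)%:E)%E.
Proof.
move=> oD Doo Cf mg ig2 weak teta eta01.
have mD := open_lebesgue_measurable oD.
have [phi tphi [C C0 [phi_cvg phiC gradC phi0]]] :=
  cutoff_difference_quotients i oD Cf teta eta01.
pose f' x := gradient f x 0 i.
have [Ceta _ _] := teta.
have mcont (u : 'rV[R]_N -> R) : (forall x, D x -> {for x, continuous u}) ->
    @measurable_fun _ _ LM _ D u.
  exact: continuous_lebesgue_measurable.
have cf' x : D x -> {for x, continuous f'}.
  exact: C1_on_gradient_continuous Cf.
have ceta x : {for x, continuous eta} by exact: C1_on_continuous Ceta _.
have mf' := mcont _ cf'.
have meta := mcont _ (fun x _ => ceta x).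
have mphi k : @measurable_fun _ _ LM _ D (phi k).
  by apply: mcont => x _; have [Cphi _ _] := tphi k; exact: C1_on_continuous Cphi _.
(* Dominates [g * phi k], because [|g| <= 1 + g^2]. *)
have ig1 : leb.-integrable D (fun x => (C * (1 + g x ^+ 2))%:E).
  rewrite (_ : (fun x => _) = (fun x => C%:E * (1%:E + (g x ^+ 2)%:E))%E); last first.
    by apply/funext => x; rewrite -EFinD -EFinM.
  apply: integrableZl => //; apply: integrableD => //.
  apply: (bounded_integrable (f := cst 1) (C := 1)) => // x _.
  by rewrite normr1.
have lim1 : (\int[leb]_(x in D) (f' x * phi k x)%:E)%E @[k --> \oo] -->
    (\int[leb]_(x in D) (f' x * (f' x * eta x))%:E)%E.
  apply: (dominated_cvg_integral (g := cst (C * C))) => //.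
  - by move=> k; exact: measurable_funM.
  - by apply: measurable_funM => //; exact: measurable_funM.
  - by move=> x Dx; apply: cvgMr; exact: phi_cvg.
  - apply: (bounded_integrable (C := C * C)) => // x _.
    by rewrite ger0_norm// mulr_ge0.
  - move=> k x Dx; rewrite normrM /=; have [Sx|nSx] := pselect (supp eta x).
      by apply: ler_pM => //; exact: gradC.
    by rewrite phi0// normr0 mulr0 mulr_ge0.
have lim2 : (\int[leb]_(x in D) (g x * phi k x)%:E)%E @[k --> \oo] -->
    (\int[leb]_(x in D) (g x * (f' x * eta x))%:E)%E.
  apply: (@dominated_cvg_integral _ LM R leb D (fun k x => g x * phi k x)
    (fun x => g x * (f' x * eta x)) (fun x => C * (1 + g x ^+ 2))) => //.
  - by move=> k; exact: measurable_funM.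
  - by apply: measurable_funM => //; exact: measurable_funM.
  - by move=> x Dx; apply: cvgMr; exact: phi_cvg.
  - move=> k x Dx; rewrite normrM mulrC ler_pM//.
    by rewrite -[g x ^+ 2]real_normK ?num_real//; have := normr_ge0 (g x); nra.
have eq12 : (\int[leb]_(x in D) (g x * (f' x * eta x))%:E =
    \int[leb]_(x in D) (f' x ^+ 2 * eta x)%:E)%E.
  under [RHS]eq_integral do rewrite expr2 -mulrA.
  have weakE : (fun k => \int[leb]_(x in D) (g x * phi k x)%:E)%E =
      (fun k => \int[leb]_(x in D) (f' x * phi k x)%:E)%E.
    by apply/funext => k; exact: weak.
  rewrite weakE in lim2; exact: (cvg_unique _ lim2 lim1).
have ife : leb.-integrable D (fun x => (f' x ^+ 2 * eta x)%:E).
  apply: (compact_support_integrable oD (S := supp eta)).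
  - by case: teta.
  - by case: teta.
  - move=> x Dx; apply: continuousM => //.
    by apply: (@continuousM _ _ f' f'); exact: cf'.
  - by move=> x _ /not_supp ->; rewrite mulr0.
have igf : leb.-integrable D (fun x => (g x * (f' x * eta x))%:E).
  apply: (le_integrable mD _ _ ig1).
    by apply/measurable_EFinP; apply: measurable_funM => //; exact: measurable_funM.
  move=> x Dx; rewrite /= lee_fin [leRHS]ger0_norm; last first.
    by rewrite mulr_ge0// addr_ge0// sqr_ge0.
  rewrite normrM mulrC; apply: ler_pM => //.
    rewrite normrM; have [Sx|/not_supp ->] := pselect (supp eta x); last first.
      by rewrite normr0 mulr0.
    rewrite -[leRHS]mulr1 ler_pM//; first exact: gradC.
    by have /andP[? ?] := eta01 x; rewrite ger0_norm.
  by rewrite -[g x ^+ 2]real_normK ?num_real//; have := normr_ge0 (g x); nra.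
have := le_integral mD igf (integrableD mD (integrableZl mD 2^-1 ig2)
  (integrableZl mD 2^-1 ife)).
rewrite eq12 integralD//; [|exact: integrableZl|exact: integrableZl].
rewrite !integralZl//.
move: (integrable_fin_num mD ig2) (integrable_fin_num mD ife).
move=> /fineK <- /fineK <-; rewrite -!EFinM -EFinD !lee_fin.
set a := fine _; set b := fine _ => le_ab.
suff : a <= 2^-1 * b + 2^-1 * a by lra.
(* Young's inequality, from [eta (g - f')^2 >= 0] and [eta <= 1]. *)
apply: le_ab => x Dx; rewrite -!EFinM -EFinD lee_fin.
have /andP[e0 e1] := eta01 x.
have := sqr_ge0 (g x - f' x).
have := sqr_ge0 (g x).
nra.
Qed.

End gradient_L2.

Section H1_C1.
Context {R : realType} {n : nat}.
Local Notation E := 'rV[R]_n.+1.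
Implicit Types (D : set E) (f w : E -> R) (G : E -> E) (x : E).
Local Notation leb := (lebesgue_rV R n.+1).
Local Notation LM := (caratheodory_type (@lebesgue_om R n.+1)).

Lemma L2_onP D f : open D -> L2_on D f <->
  @measurable_fun _ _ LM _ D f /\ leb.-integrable D (fun x => (f x ^+ 2)%:E).
Proof.
move=> oD; have mD := open_lebesgue_measurable oD.
have sqrE : (EFin \o (fun x : LM => (f \_ D) x ^+ 2)) = (fun x => (f x ^+ 2)%:E) \_ D.
  by apply/funext => x; rewrite /patch /=; case: ifPn => // _; rewrite expr0n.
split=> [fL2|[mf if2]].
  split; last first.
    by apply/(integrable_mkcond _ mD); rewrite -sqrE; exact: Lfun2_integrable_sqr.
  apply/(measurable_restrictT _ mD).
  by move: fL2; rewrite /L2_on inE => /andP[]; rewrite inE.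
rewrite /L2_on inE; apply/andP; split; rewrite inE /=.
  exact/(measurable_restrictT _ mD).
rewrite /finite_norm unlock; apply: poweR_lty.
have -> : (\int[leb]_x (`|(EFin \o f \_ D) x| `^ 2) =
    \int[leb]_x (EFin \o (fun x : LM => ((f \_ D) x ^+ 2)%R)) x)%E.
  by apply: eq_integral => x _; rewrite /= powR_mulrn// real_normK// num_real.
rewrite sqrE -integral_mkcond; exact: integrable_lty.
Qed.

(** [G] and the pointwise gradient agree against test functions, so [cutoff_gradient_le] applies
    with a bound independent of the cutoff. Monotone convergence along cutoffs increasing to 1 on
    [D] carries it over to the gradient. *)
Lemma L2_on_gradient D f G i : open D -> (leb D < +oo)%E -> C1_on D f ->
  H1_with D f G -> L2_on D (fun x => gradient f x 0 i).
Proof.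
move=> oD Doo Cf [_ GL2 Gw]; have [mg ig2] := (L2_onP _ oD).1 (GL2 i).
have mD := open_lebesgue_measurable oD.
have weak phi : test_function D phi ->
    (\int[leb]_(x in D) (G x 0 i * phi x)%:E =
     \int[leb]_(x in D) (gradient f x 0 i * phi x)%:E)%E.
  move=> tphi; apply: oppe_inj.
  by rewrite -(Gw phi tphi i) -(C1_weak_gradient oD Cf tphi i).
have [eta [teta eta01 eta_nd eta1]] := exists_cutoff oD.
have mcont (u : E -> R) : (forall x, D x -> {for x, continuous u}) ->
    @measurable_fun _ _ LM _ D u.
  exact: continuous_lebesgue_measurable.
have mf' : @measurable_fun _ _ LM _ D (fun x => gradient f x 0 i).
  by apply: mcont => x Dx; exact: C1_on_gradient_continuous Cf Dx.
apply/(L2_onP _ oD); split => //.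
have mf'2 : @measurable_fun _ _ LM _ D (fun x => gradient f x 0 i ^+ 2).
  exact: measurable_funX.
apply/integrableP; split; first exact/measurable_EFinP.
under eq_integral do rewrite gee0_abs ?lee_fin ?sqr_ge0//.
apply: (@le_lt_trans _ _ (\int[leb]_(x in D) (G x 0 i ^+ 2)%:E)%E); last first.
  exact: integrable_lty.
pose g k x := (gradient f x 0 i ^+ 2 * eta k x)%:E.
have g0 k x : (0 <= g k x)%E.
  by rewrite lee_fin mulr_ge0 ?sqr_ge0//; case/andP: (eta01 k x).
have mg_ k : @measurable_fun _ _ LM _ D (g k).
  apply/measurable_EFinP; apply: measurable_funM => //.
  by apply: mcont => x _; have [Ce _ _] := teta k; exact: C1_on_continuous Ce _.
have nd_g x : {homo g ^~ x : k l / (k <= l)%N >-> (k <= l)%E}.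
  apply/nondecreasing_seqP => k; rewrite lee_fin ler_wpM2l ?sqr_ge0//.
have glim x : D x -> limn (g ^~ x) = (gradient f x 0 i ^+ 2)%:E.
  move=> Dx; apply: lim_near_cst => //.
  by apply: filterS (eta1 x Dx) => k ek; rewrite /g ek mulr1.
have := @cvg_monotone_convergence _ LM R leb D mD g mg_ (fun k x _ => g0 k x)
  (fun x _ => nd_g x).
have -> : (\int[leb]_(x in D) limn (g ^~ x) = \int[leb]_(x in D) (gradient f x 0 i ^+ 2)%:E)%E.
  by apply: eq_integral => x /set_mem /glim.
move=> lim_g; apply: (cvge_to_le lim_g); apply: nearW => k.
exact: cutoff_gradient_le.
Qed.

End H1_C1.

(** * Closures, local constancy and connectedness *)

Section topology_lemmas.
Context {R : realType}.

(** Passes from boundary to interior points: it will give a point of [Om] where [p > m], and one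
    where [p] is close to its value at a point of [Gp]. *)
Lemma within_closure_meets (T U : topologicalType) (A : set T) (f : T -> U) x
  (V : set U) : {within closure A, continuous f} -> closure A x -> open V ->
  V (f x) -> exists2 y, A y & V (f y).
Proof.
move=> cf Ax oV Vfx.
have nV : within (closure A) (nbhs x) (f @^-1` V).
  by rewrite nbhs_subspace_in//; exact: (cf x V (open_nbhs_nbhs (conj oV Vfx))).
have [y [Ay Vy]] := Ax _ nV; exists y => //.
by apply: Vy; exact: subset_closure.
Qed.

Lemma bounded_closure_compact N (A : set 'rV[R]_N) :
  bounded_set A -> compact (closure A).
Proof.
move=> [M [_ AM]]; apply: bounded_closed_compact; last exact: closed_closure.
have sub : closure A `<=` closed_ball_ Num.norm 0 (`|M| + 1).
  rewrite [X in _ `<=` X](closure_id _).1; last exact: closed_closed_ball_.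
  apply: closureS => x Ax; rewrite /closed_ball_ /= sub0r normrN.
  by apply: AM => //; rewrite (le_lt_trans (ler_norm M))// ltrDl.
exists (`|M| + 1); split; first exact: num_real.
move=> r Mr x /sub; rewrite /closed_ball_ /= sub0r normrN => xM.
exact: le_trans (ltW Mr).
Qed.

(** Inside a ball contained in [D], the mean value bound on the segment from [x] to [y] holds with
    constant 0. *)
Lemma gradient0_cst N (D : set 'rV[R]_N) f x :
  open D -> (forall y, D y -> differentiable f y) ->
  (forall y, D y -> gradient f y = 0) -> D x ->
  \forall y \near x, f y = f x.
Proof.
move=> oD df gf0 Dx.
have D0 v z : D z -> 'D_v f z = 0.
  move=> Dz; rewrite deriveE; last exact: df.
  rewrite [v]row_sum_delta linear_sum big1// => i _.
  rewrite linearZ/= -deriveE; last exact: df.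
  by have /rowP/(_ i) := gf0 z Dz; rewrite !mxE => ->; rewrite scaler0.
move: (oD); rewrite openE => /(_ x Dx) /nbhs_ballP[e /= e0 eD].
apply/nbhs_ballP; exists e => // y; rewrite mx_norm_ball /ball_ /= => xy.
have : `|1^-1 * (f (x + 1 *: (y - x)) - f x)| <= 0.
  apply: difference_quotient_le => // t /andP[t0 t1].
  have Dt : D (x + t *: (y - x)).
    apply: eD; rewrite mx_norm_ball /ball_ /= opprD addrA subrr add0r normrN.
    rewrite normrZ ger0_norm// distrC; apply: le_lt_trans xy.
    by rewrite ler_piMl.
  by split; [exact: df|rewrite D0// normr0].
rewrite invr1 mul1r scale1r [x + _]addrC subrK normr_le0 subr_eq0 => /eqP; exact.
Qed.

(** The level set of [f x] is open and closed in [D]. Local constancy is asked on this level alone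
    because grad p will be known to vanish just where [p > m]. *)
Lemma connected_locally_constant N (D : set 'rV[R]_N) (f : 'rV[R]_N -> R) x :
  open D -> connected D -> (forall y, D y -> {for y, continuous f}) -> D x ->
  (forall y, D y -> f y = f x -> \forall z \near y, f z = f y) ->
  forall y, D y -> f y = f x.
Proof.
move=> oD cD cf Dx lc y Dy.
suff : D `&` [set z | f z = f x] = D by move=> e; move: Dy; rewrite -e => -[].
apply: cD; first by exists x.
  exists (D `&` [set z | f z = f x]); last by rewrite setIA setIid.
  rewrite openE => z [Dz /= fz]; apply: filterI.
    by move: oD; rewrite openE; apply.
  by apply: filterS (lc z Dz fz) => u; rewrite fz.
exists (~` (D `&` [set z | f z != f x])).
  apply: open_closedC; rewrite openE => z [Dz /= fz]; apply: filterI.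
    by move: oD; rewrite openE; apply.
  exact: (cf z Dz [set s | s != f x] (open_nbhs_nbhs (conj (@open_neq _ (f x)) fz))).
apply/seteqP; split => z [Dz /= fz]; split => //=.
  by move=> [_]; rewrite fz eqxx.
by apply: contrapT => /eqP nfz; apply: fz.
Qed.

End topology_lemmas.

(** * The maximum principle *)

Section truncation.
Context {R : realType} {n : nat}.
Local Notation E := 'rV[R]_n.+1.
Implicit Types (D : set E) (p w : E -> R) (x : E).
Local Notation leb := (lebesgue_rV R n.+1).
Local Notation LM := (caratheodory_type (@lebesgue_om R n.+1)).

Lemma gradient_ramp p (m : R) x : differentiable p x ->
  gradient (fun y => ramp (p y - m)) x = (2 * Num.max 0 (p x - m)) *: gradient p x.
Proof.
move=> dp; have dcst := differentiable_cst (- m) x.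
have [dr rE] := is_derive_ramp (p x - m).
rewrite (gradient_comp (f := p + cst (- m)) (differentiableD dp dcst))//.
by rewrite gradientD// gradient_cst addr0 derive1E -rE.
Qed.

(** [p] is bounded, being continuous on a compact closure. So the truncation is bounded and its
    gradient is a bounded multiple of grad p, square integrable by [L2_on_gradient]. *)
Lemma H1_with_ramp D p G (m : R) : open D -> bounded_set D -> C1_on D p ->
  {within closure D, continuous p} -> H1_with D p G ->
  H1_with D (fun x => ramp (p x - m)) (gradient (fun x => ramp (p x - m))).
Proof.
move=> oD bD Cp cp pG; have Doo := bounded_lebesgue_lty bD.
have mD := open_lebesgue_measurable oD.
have [dp _] := Cp.
have Cpm : C1_on D (fun x => p x - m).
  exact: (C1_onD oD Cp (C1_on_cst D (- m))).
have Cw := C1_on_ramp oD Cpm.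
have [C [C0 pC]] : exists C, 0 <= C /\ forall x, D x -> Num.max 0 (p x - m) <= C.
  have := continuous_compact cp (bounded_closure_compact bD).
  move=> /compact_bounded[M [_ Mp]]; exists (`|M| + 1 + `|m|).
  split=> [|x Dx]; first by rewrite !addr_ge0.
  have : `|p x| <= `|M| + 1.
    apply: Mp; first by rewrite (le_lt_trans (ler_norm M))// ltrDl.
    by exists x => //; exact: subset_closure.
  rewrite ge_max !addr_ge0//= => pM; apply: le_trans (ler_norm _) _.
  by apply: le_trans (ler_normB _ _) _; rewrite lerD2r.
have mcont (u : E -> R) : (forall x, D x -> {for x, continuous u}) ->
    @measurable_fun _ _ LM _ D u.
  exact: continuous_lebesgue_measurable.
split; last exact: C1_weak_gradient.
- apply/(L2_onP _ oD).
  have mw : @measurable_fun _ _ LM _ D (fun x => ramp (p x - m)).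
    by apply: mcont => x Dx; exact: C1_on_continuous Cw Dx.
  split => //; apply: (bounded_integrable (C := (C ^+ 2) ^+ 2)) => //.
    exact: measurable_funX.
  move=> x Dx; rewrite ger0_norm ?sqr_ge0// ler_sqr ?nnegrE ?sqr_ge0//.
  by rewrite /ramp ler_sqr ?nnegrE ?le_max ?lexx//; exact: pC.
- move=> i; have [mg ig2] := (L2_onP _ oD).1 (L2_on_gradient i oD Doo Cp pG).
  have mw : @measurable_fun _ _ LM _ D (fun x => gradient (fun x => ramp (p x - m)) x 0 i).
    by apply: mcont => x Dx; exact: C1_on_gradient_continuous Cw Dx.
  apply/(L2_onP _ oD); split => //.
  apply: (le_integrable mD _ _ (integrableZl mD ((2 * C) ^+ 2) ig2)).
    by apply/measurable_EFinP; exact: measurable_funX.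
  move=> x Dx; rewrite -EFinM !gee0_abs ?lee_fin ?(mulr_ge0 (sqr_ge0 _) (sqr_ge0 _)) ?sqr_ge0//.
  rewrite gradient_ramp ?mxE; last exact: dp.
  rewrite exprMn ler_wpM2r ?sqr_ge0// ler_sqr ?nnegrE ?mulr_ge0 ?le_max ?lexx//.
  by rewrite ler_wpM2l//; exact: pC.
Qed.

(** The constant sequence [w] approximates itself: all the distances in the definition of [trace]
    are 0. *)
Lemma trace_continuous D w G : open D -> {within closure D, continuous w} ->
  H1_with D w G -> trace D w w.
Proof.
move=> oD cw wG; split.
  apply: within_continuous_measurable; first exact: hausdorff_halfspace.
  exact: (continuous_subspaceW (@subDsetl _ (closure D) D) cw).
have L2_0 (u : E -> R) : L2_cvg D (fun=> u) u.
  apply: cvg_near_cst; apply: nearW => _; rewrite -[RHS](Lnorm0 leb (p := 2%:E))//.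
  congr (Lnorm _ _ _); apply/funext => x.
  by rewrite /patch /=; case: ifP => //; rewrite subrr.
exists G, (fun=> w), (fun=> G); split => //.
apply: cvg_near_cst; apply: nearW => _; apply: integral0_eq => x _.
by rewrite subrr expr0n.
Qed.

End truncation.

Theorem theorem6 (R : realType) (n : nat)
  (Om Gp Gv : set 'rV[R]_n.+1)
  (hOm : lipschitz_domain Om)
  (hGU : Gp `|` Gv = boundary Om) (hGI : Gp `&` Gv = set0) (hGp : Gp !=set0)
  (K : 'rV[R]_n.+1 -> 'M[R]_n.+1) (k1 k2 : R)
  (hk1 : 0 < k1) (hk12 : k1 <= k2)
  (hKsym : forall x, Om x -> (K x)^T = K x)
  (hKell : forall x, Om x -> forall z : 'rV[R]_n.+1, z != 0 ->
    k1 * dotv z z <= dotv z (z *m (K x)^T) <= k2 * dotv z z)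
  (mu0 p0 beta : R) (hmu0 : 0 < mu0) (hp0 : 0 < p0) (hbeta : 0 <= beta)
  (rho xi : 'rV[R]_n.+1 -> R) (b : 'rV[R]_n.+1 -> 'rV[R]_n.+1)
  (hxi : forall x, Om x -> differentiable xi x)
  (hb : forall x, Om x -> rho x *: b x = - gradient xi x)
  (pp vn p : 'rV[R]_n.+1 -> R) (v : 'rV[R]_n.+1 -> 'rV[R]_n.+1)
  (hsol : weak_solution Om Gp Gv K mu0 p0 beta xi pp vn p v)
  (hvn : forall x, Gv x -> 0 <= vn x) :
  forall x, closure Om x -> ((p x)%:E <= ereal_sup [set (pp y)%:E | y in Gp])%E.
Proof.
case: hOm => oOm cOm bOm _.
case: hsol => -[Gr pGr] Cp cp p_bc vE balance.
have [y0 Gpy0] := hGp; have Gp_cl y : Gp y -> closure Om y.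
  by move=> Gpy; have [] : boundary Om y by rewrite -hGU; left.
move=> x clx; rewrite leNgt; apply/negP => supx.
(* The supremum is a real number: [Gp] is nonempty, which excludes -oo, and it is below [p x], which
   excludes +oo. *)
have [m ppm mx] : exists2 m, forall y, Gp y -> pp y <= m & m < p x.
  have sup_ge y : Gp y -> ((pp y)%:E <= ereal_sup [set (pp y)%:E | y in Gp])%E.
    by move=> Gpy; apply: ereal_sup_ubound; exists y.
  move: supx sup_ge; case: ereal_sup => [m| |].
  - by rewrite lte_fin => mx ppm; exists m => // y /ppm; rewrite lee_fin.
  - by rewrite ltNge leey.
  - by move=> _ /(_ _ Gpy0).
have [dp cgp] := Cp.
have cpOm y : Om y -> {for y, continuous p} by exact: C1_on_continuous Cp.
pose w y := ramp (p y - m).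
have wG := H1_with_ramp m oOm bOm Cp cp pGr.
have cw : {within closure Om, continuous w}.
  have cramp : continuous (fun s : R => ramp (s - m)).
    move=> s; apply: (@continuous_comp _ _ _ (fun s => s - m) ramp).
      by apply: (@continuousD _ _ _ id (cst (- m))) => //; exact: cst_continuous.
    apply: differentiable_continuous; apply/derivable1_diffP.
    exact: (@ex_derive _ _ _ _ _ _ _ (is_derive_ramp (s - m))).
  move=> y; apply: (@continuous_comp (subspace (closure Om)) _ _ p (fun s : R => ramp (s - m))).
    exact: cp.
  exact: cramp.
have w_trace := trace_continuous oOm cw wG.
have w_Gp : vanishes_on Gp w.
  apply: aeW => y Gpy; rewrite /w ramp_le0// subr_le0 p_bc//; exact: ppm.
have [int_wv _ balance_eq] := balance _ _ _ wG w_trace w_Gp.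
have mOm := open_lebesgue_measurable oOm.
pose F y := dotv (gradient w y) (v y).
have dotv_ge0 (z : 'rV[R]_n.+1) : 0 <= dotv z z.
  by apply: sumr_ge0 => i _; rewrite -expr2 sqr_ge0.
(* The constant combines the inverse viscosity, the lower ellipticity bound and the 2 from the
   derivative of [ramp]. It depends on [y], but only its sign matters. *)
have F_le y : Om y -> exists2 c, 0 < c &
    F y <= - (Num.max 0 (p y - m) * (c * dotv (gradient p y) (gradient p y))).
  move=> Oy; pose c := (modified_viscosity mu0 p0 beta xi y * barus p0 beta (p y))^-1.
  have c0 : 0 < c by rewrite invr_gt0 !mulr_gt0 ?expR_gt0.
  exists (2 * c * k1); first by rewrite !mulr_gt0.
  have dotvZZ (s t : R) (z z' : 'rV[R]_n.+1) : dotv (s *: z) (t *: z') = s * t * dotv z z'.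
    by rewrite /dotv mulr_sumr; apply: eq_bigr => j _; rewrite !mxE mulrACA.
  rewrite /F /w gradient_ramp; last exact: dp.
  rewrite vE// -/c dotvZZ mulrN mulNr lerN2.
  have -> : Num.max 0 (p y - m) * (2 * c * k1 * dotv (gradient p y) (gradient p y)) =
      2 * Num.max 0 (p y - m) * c * (k1 * dotv (gradient p y) (gradient p y)).
    by ring.
  apply: ler_wpM2l; first by rewrite !mulr_ge0 ?(ltW c0)// le_max lexx.
  have [->|z0] := eqVneq (gradient p y) 0.
    rewrite mul0mx (_ : dotv 0 0 = 0) ?mulr0//.
    by rewrite /dotv big1// => j _; rewrite mxE mul0r.
  by have /andP[] := hKell y Oy _ z0.
have F_le0 y : Om y -> F y <= 0.
  move=> Oy; have [c c0] := F_le y Oy; move/le_trans; apply.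
  by rewrite oppr_le0 !mulr_ge0 ?(ltW c0)// le_max lexx.
(* As [F <= 0], the integral of [|F|] is minus that of [F], which by the balance is minus the
   boundary integral of [w vn], hence at most 0. *)
have F_ae : {ae lebesgue_rV R n.+1, forall y, Om y -> (F y)%:E = 0%E}.
  have mF := measurable_int _ int_wv.
  apply/(ae_eq_integral_abs (lebesgue_rV R n.+1) mOm mF).
  rewrite (eq_integral (fun y : caratheodory_type (@lebesgue_om R n.+1) => - (F y)%:E)%E);
    last first.
    by move=> y /set_mem Oy; rewrite lee0_abs// lee_fin F_le0.
  apply/eqP; rewrite eq_le; apply/andP; split; last first.
    by apply: integral_ge0 => y Oy; rewrite -EFinN lee_fin oppr_ge0 F_le0.
  rewrite integralN; last by rewrite fin_num_adde_defl// ?fin_numN integrable_neg_fin_num.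
  rewrite balance_eq oppe_le0; apply: integral_ge0 => y Gvy.
  rewrite lee_fin mulr_ge0 ?hvn//; exact: ramp_ge0.
have gradp0 y : Om y -> m < p y -> gradient p y = 0.
  (* [V] is open by continuity of [p] and of its gradient, and null because [F < 0] on it. *)
  pose V := [set z | [/\ Om z, m < p z & gradient p z != 0]].
  have oV : open V.
    rewrite openE => z [Oz mz gz]; apply: filterS3 (fun a b c d => And3 b c d) _ _ _.
    - by move: oOm; rewrite openE; apply.
    - exact: (cpOm z Oz [set s | m < s] (open_nbhs_nbhs (conj (@open_gt _ m) mz))).
    - have cz : gradient p u @[u --> z] --> gradient p z := cgp z Oz.
      exact: (cvgr_neq0 _ cz gz).
  have V0 : V = set0.
    apply: (open_null_eq0 oV).
    have [N [_ N0 FN]] := F_ae.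
    apply/eqP; rewrite eq_le measure_ge0 andbT -N0.
    apply: (le_outer_measure (@lebesgue_om R n.+1)) => z [Oz mz gz].
    apply: FN => /(_ Oz) [] Fz; have [c c0] := F_le z Oz.
    rewrite Fz; apply/negP; rewrite -ltNge oppr_lt0.
    rewrite !mulr_gt0 ?lt_max ?subr_gt0 ?mz ?orbT//.
    by apply: (lt_le_trans _ (dotv_ge_norm _)); rewrite exprn_gt0// normr_gt0.
  move=> Oy my; apply/eqP/negPn/negP => gy.
  by have : V y by []; rewrite V0.
have lc c : m < c -> forall y, Om y -> p y = c -> \forall z \near y, p z = p y.
  move=> mc y Oy pyc; pose U := [set z | Om z /\ m < p z].
  have oU : open U.
    rewrite openE => z [Oz mz]; apply: filterI; first by move: oOm; rewrite openE; apply.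
    exact: (cpOm z Oz [set s | m < s] (open_nbhs_nbhs (conj (@open_gt _ m) mz))).
  apply: (gradient0_cst oU); last by split => //; rewrite pyc.
    by move=> z [Oz _]; exact: dp.
  by move=> z [Oz mz]; exact: gradp0.
have [x1 Ox1 mx1] := within_closure_meets cp clx (@open_gt _ m) mx.
(* Now [p] is constant on [Om] with the value [p x1 > m], whereas near [y0] in [Gp], where
   [p y0 <= m], it has to take values below [p x1]. *)
have pE := connected_locally_constant oOm cOm cpOm Ox1 (lc _ mx1).
have py0 : p y0 < p x1 by rewrite (le_lt_trans _ mx1)// p_bc//; exact: ppm.
have [z Oz /=] := within_closure_meets cp (Gp_cl _ Gpy0) (@open_lt _ (p x1)) py0.
by rewrite pE// ltxx.
Qed.
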